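(* There exists an algorithm that, given a graph $G$ of order $n$, computes ${\rm I}_e(G)$ in time $2^{O(vc^4)}\cdot n^{O(1)}$, where $vc$ is the size of a minimum vertex cover of $G$.
   Context: All graphs are finite and simple. A graph is locally irregular if no two adjacent vertices have the same degree. An edge-irregulator of a graph $G$ is a set $S\subseteq E(G)$ such that $G-S$ is locally irregular; ${\rm I}_e(G)$ is the minimum cardinality of an edge-irregulator of $G$. *)

(* Defs.v *)
From mathcomp Require Import all_boot.
Set Implicit Arguments. Unset Strict Implicit. Unset Printing Implicit Defensive.

Record sgraph (n : nat) := SGraph {
  adj : rel 'I_n;
  adj_sym : symmetric adj;
  adj_irr : irreflexive adj }.

Definition edges n (G : sgraph n) : {set 'I_n * 'I_n} :=
  [set p : 'I_n * 'I_n | (val p.1 < val p.2)%N && adj G p.1 p.2].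

Definition adj_del n (G : sgraph n) (S : {set 'I_n * 'I_n}) (x y : 'I_n) : bool :=
  adj G x y && ((x, y) \notin S) && ((y, x) \notin S).

Definition deg_del n (G : sgraph n) (S : {set 'I_n * 'I_n}) (x : 'I_n) : nat :=
  #|[set y | adj_del G S x y]|.

Definition locally_irregular_del n (G : sgraph n) (S : {set 'I_n * 'I_n}) : bool :=
  [forall x, forall y, adj_del G S x y ==> (deg_del G S x != deg_del G S y)].

Definition edge_irregulator n (G : sgraph n) (S : {set 'I_n * 'I_n}) : bool :=
  (S \subset edges G) && locally_irregular_del G S.

(* I_e(G): minimum size of an edge-irregulator (E(G) itself is one, so the
   minimum below, with default #|E(G)|, is the true minimum). *)
Definition Ie n (G : sgraph n) : nat :=
  \big[minn/#|edges G|]_(S : {set 'I_n * 'I_n} | edge_irregulator G S) #|S|.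

(* Vertex covers and vc(G) (setT is a cover of size n). *)
Definition vertex_cover n (G : sgraph n) (C : {set 'I_n}) : bool :=
  [forall x, forall y, adj G x y ==> (x \in C) || (y \in C)].

Definition vc n (G : sgraph n) : nat :=
  \big[minn/n]_(C : {set 'I_n} | vertex_cover G C) #|C|.

Definition sym := option bool.   (* None = blank *)
Inductive move := MLeft | MRight | MStay.

Record TM := {
  tm_state : finType;
  tm_start : tm_state;
  tm_halt : pred tm_state;
  tm_delta : tm_state -> sym -> tm_state * sym * move }.

(* configuration: state, left part (nearest cell first), head cell, right part *)
Definition config (M : TM) := (tm_state M * seq sym * sym * seq sym)%type.

Definition step (M : TM) (c : config M) : config M :=
  let: (q, l, h, r) := c in
  if @tm_halt M q then c else
  let: (q', w, mv) := @tm_delta M q h in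
  match mv with
  | MStay => (q', l, w, r)
  | MLeft => match l with
             | [::] => (q', [::], None, w :: r)
             | a :: l' => (q', l', a, w :: r)
             end
  | MRight => match r with
              | [::] => (q', w :: l, None, [::])
              | a :: r' => (q', w :: l, a, r')
              end
  end.

Definition run (M : TM) (t : nat) (c : config M) : config M := iter t (@step M) c.

Definition init_config (M : TM) (w : seq sym) : config M :=
  match w with
  | [::] => (@tm_start M, [::], None, [::])
  | a :: w' => (@tm_start M, [::], a, w')
  end.

Definition halted (M : TM) (c : config M) : bool := let: (q, _, _, _) := c in @tm_halt M q.

Fixpoint bits_until_blank (s : seq sym) : seq bool :=
  match s with
  | Some b :: s' => b :: bits_until_blank s'
  | _ => [::]
  end.

Definition bin_val (s : seq bool) : nat := foldl (fun acc (b : bool) => acc.*2 + b) 0 s.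

Definition output (M : TM) (c : config M) : nat :=
  let: (_, _, h, r) := c in bin_val (bits_until_blank (h :: r)).

Definition encode n (G : sgraph n) : seq sym :=
  nseq n (Some true) ++ Some false ::
  [seq Some (adj G i j) | i <- enum 'I_n, j <- enum 'I_n].

(* Main.v *)
Require Import Defs.
From mathcomp Require Import all_boot.
From mathcomp Require Import all_fingroup zify.
Set Implicit Arguments. Unset Strict Implicit. Unset Printing Implicit Defensive.

(* Let k = vc(G), attained by the cover C. Deleting the edges inside C and all edges at the
   vertices of C with at most k neighbours outside C leaves a locally irregular graph, so
   I_e(G) <= 2 k^2. Call u, v twins when they have the same neighbourhood. Exchanging twins is an
   automorphism, so an irregulator with s edges can be moved into the set of edges between
   vertices that have fewer than 2s smaller twins. There are at most k + 2^k * 2s such vertices,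
   hence 2^{O(k^3)} candidates with at most s edges for each s <= I_e(G). For s = 0, 1, 2, ... the
   algorithm tries these candidates in the order of the binary numbers they represent.

   The algorithm is a program with registers and unbounded bit arrays, in which only the
   outermost loop is not a bounded one. A Turing machine simulates each elementary instruction
   by sweeps over the part of the tape in use; the latter grows by at most one block per
   instruction, so the running time is quadratic in the number of instructions. *)

(** * Structured Turing-machine programs *)

(** The program computes neither [vc G] nor a minimum cover; both occur in the analysis only, and
    the budget s simply grows until the first success. The obstacle is the enumeration. The number
    of allowed pairs is only bounded by 2^{O(k)}, so running through all subsets of them could be
    doubly exponential: the successor has to jump over the sets with more than s elements, and then
    a round is paid for by a small set. It also has to be computed from the current set alone, since
    a fixed number of registers and arrays leaves no room for a list of candidates. A binary
    increment with a modified carry does both, in one sweep over a matrix. Candidates are sets of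
    ordered pairs without a prescribed orientation, because an exchange of twins does not respect
    the order of the vertices; orienting the pairs afterwards does not increase their number. *)

Inductive prog :=
| Nop
| Mv of move
| Wr of sym
| Sq of prog & prog
| Ifc of pred sym & prog & prog
| Whl of pred sym & prog.

Notation "p ;; q" := (Sq p q) (at level 60, right associativity).

Definition put (f : nat -> sym) (x : nat) (s : sym) : nat -> sym :=
  fun y => if y == x then s else f y.

(* Cells are numbered from right to left, cell 0 being the rightmost one ever visited;
   hence [MLeft] increments the position. *)
Inductive exec : prog -> (nat -> sym) -> nat -> nat -> (nat -> sym) -> nat -> Prop :=
| ENop f x : exec Nop f x 0 f x
| EL f x : exec (Mv MLeft) f x 1 f x.+1
| ER f x : exec (Mv MRight) f x.+1 1 f x
| ES f x : exec (Mv MStay) f x 1 f x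
| EW s f x : exec (Wr s) f x 1 (put f x s) x
| ESeq p q f x t g y u h z :
    exec p f x t g y -> exec q g y u h z -> exec (p ;; q) f x (t + u) h z
| EIfT (b : pred sym) p q f x t g y :
    b (f x) -> exec p f x t g y -> exec (Ifc b p q) f x t.+2 g y
| EIfF (b : pred sym) p q f x t g y :
    b (f x) = false -> exec q f x t g y -> exec (Ifc b p q) f x t.+1 g y
| EWhlF (b : pred sym) p f x : b (f x) = false -> exec (Whl b p) f x 1 f x
| EWhlT (b : pred sym) p f x t g y u h z :
    b (f x) -> exec p f x t g y -> exec (Whl b p) g y u h z ->
    exec (Whl b p) f x (t + u).+2 h z.

(** * Compilation into a transition table *)

Definition instr := sym -> nat * sym * move.

Fixpoint code_len (p : prog) : nat :=
  match p with
  | Nop => 0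
  | Mv _ | Wr _ => 1
  | Sq p q => code_len p + code_len q
  | Ifc _ p q => (code_len p + code_len q).+2
  | Whl _ p => (code_len p).+2
  end.

Definition jump (k : nat) : instr := fun a => (k, a, MStay).
Definition branch (b : pred sym) (k l : nat) : instr :=
  fun a => (if b a then k else l, a, MStay).

(** Jump targets are absolute, so the code depends on the address k where it is placed. The true
    branch of [Ifc] ends with a jump over the false one, which itself falls through; hence the costs
    [t.+2] and [t.+1] in [exec]. *)
Fixpoint code (p : prog) (k : nat) : seq instr :=
  match p with
  | Nop => [::]
  | Mv m => [:: (fun a => (k.+1, a, m)) : instr]
  | Wr s => [:: (fun _ => (k.+1, s, MStay)) : instr]
  | Sq p q => code p k ++ code q (k + code_len p)
  | Ifc b p q =>
      branch b k.+1 (k + code_len p).+2 :: code p k.+1 ++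
      jump (k + code_len p + code_len q).+2 :: code q (k + code_len p).+2
  | Whl b p =>
      branch b k.+1 (k + code_len p).+2 :: code p k.+1 ++ [:: jump k]
  end.

Lemma size_code p k : size (code p k) = code_len p.
Proof.
elim: p k => //= [p IHp q IHq|b p IHp q IHq|b p IHp] k.
- by rewrite size_cat IHp IHq.
- by rewrite size_cat /= IHp IHq addnS.
- by rewrite size_cat /= IHp addn1.
Qed.

(** A state is an address, and running off the end of the code is halting. For compiled code [inord]
    is exact, since its targets never exceed [size c]. *)
Definition machine (c : seq instr) : TM :=
  {| tm_state := 'I_(size c).+1;
     tm_start := ord0;
     tm_halt := fun q => val q == size c;
     tm_delta := fun q a =>
       let: (k, w, m) := nth (jump 0) c q a in (inord k, w, m) |}.

(** Reading the lists with default blank makes the relation insensitive to trailing blanks, that is,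
    to how far the machine has already extended its lists. *)
Definition tape_rel (f : nat -> sym) (x : nat) (l : seq sym) (h : sym) (r : seq sym) :=
  [/\ h = f x, forall i, nth None l i = f (x + i.+1)
    & forall i, nth None r i = if i < x then f (x - i.+1) else None].

Definition conf_rel (c : seq instr) (q : nat) f x (cf : config (machine c)) :=
  let: (s, l, h, r) := cf in val s = q /\ tape_rel f x l h r.

Lemma run_add M t u (c : config M) : run (t + u) c = run u (run t c).
Proof. by rewrite /run addnC iterD. Qed.

Definition step_tape (m : move) (x y : nat) :=
  match m with MLeft => y = x.+1 | MRight => x = y.+1 | MStay => x = y end.

Lemma step_instr c q f x cf k w m y :
  conf_rel (c := c) q f x cf -> q < size c -> nth (jump 0) c q (f x) = (k, w, m) ->
  k <= size c -> step_tape m x y ->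
  conf_rel k (put f x w) y (step cf).
Proof.
case: cf => [[[s l] h] r] /= [sq [hE lE rE]] qc ck kc xy.
rewrite sq ltn_eqF // hE ck.
have putne z : z != x -> put f x w z = f z by rewrite /put => /negbTE ->.
have putx : put f x w x = w by rewrite /put eqxx.
case: m xy ck => /= xy _.
- subst y; have l0 := lE 0; case: l lE l0 => [|a l'] lE l0 /=;
    rewrite inordK //; split => //; split=> [|i|i] /=.
  + by rewrite putne ?gtn_eqF // -addn1 -l0.
  + by have := lE i.+1; rewrite !nth_nil => ->; rewrite putne; [congr f; lia|lia].
  + case: i => [|i] /=; first by rewrite subSS subn0 putx.
    rewrite rE ltnS subSS; case: ifP => // ix; rewrite putne //; lia.
  + by rewrite putne ?gtn_eqF // -addn1 -l0.
  + by have /= -> := lE i.+1; rewrite putne; [congr f; lia|lia].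
  + case: i => [|i] /=; first by rewrite subSS subn0 putx.
    rewrite rE ltnS subSS; case: ifP => // ix; rewrite putne //; lia.
- subst x; have r0 := rE 0; case: r rE r0 => [|a r'] rE r0 /=;
    rewrite inordK //; split => //; split=> [|i|i] /=.
  + by rewrite putne ?ltn_eqF //; rewrite /= subSS subn0 in r0.
  + case: i => [|i] /=; first by rewrite addn1 putx.
    rewrite lE putne; [congr f; lia|lia].
  + rewrite nth_nil; case: ifP => // ix; rewrite putne; last lia.
    by have := rE i.+1; rewrite nth_nil ltnS ix subSS.
  + by rewrite putne ?ltn_eqF //; rewrite /= subSS subn0 in r0.
  + case: i => [|i] /=; first by rewrite addn1 putx.
    rewrite lE putne; [congr f; lia|lia].
  + have /= -> := rE i.+1; rewrite ltnS subSS; case: ifP => // ix.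
    rewrite putne //; lia.
- subst y; rewrite inordK //; split => //; split=> [|i|i] /=.
  + by rewrite putx.
  + rewrite lE putne //; lia.
  + by rewrite rE; case: ifP => // ix; rewrite putne //; lia.
Qed.

Lemma put_id f x y : put f x (f x) y = f y.
Proof. by rewrite /put; case: eqP => // ->. Qed.

Lemma conf_rel_ext c q f g x (cf : config (machine c)) :
  f =1 g -> conf_rel q f x cf -> conf_rel q g x cf.
Proof.
move=> fg; case: cf => [[[s l] h] r] /= [-> [-> lE rE]]; split=> //.
by split=> // i; rewrite ?lE ?rE -!fg.
Qed.

(** The code may stand anywhere inside [c]: with [pre] and [post] arbitrary, the induction
    hypotheses apply to subprograms in place. *)
Lemma exec_run p f x t g y : exec p f x t g y ->
  forall c pre post, c = pre ++ code p (size pre) ++ post ->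
  forall cf, conf_rel (c := c) (size pre) f x cf ->
  conf_rel (size pre + code_len p) g y (run t cf).
Proof.
have nthc pre (i : instr) post : nth (jump 0) (pre ++ i :: post) (size pre) = i.
  by rewrite nth_cat ltnn subnn.
have szc p' (c pre post : seq instr) : c = pre ++ code p' (size pre) ++ post ->
    size c = size pre + code_len p' + size post.
  by move=> ->; rewrite !size_cat size_code addnA.
elim=> {p f x t g y}.
- by move=> f x c pre post cE cf; rewrite addn0.
- move=> f x c pre post cE cf R;
  have sc := szc _ _ _ _ cE; rewrite /= in cE sc.
  apply: conf_rel_ext (put_id f x) _.
  rewrite [code_len _]/= addn1; apply: (step_instr (m := MLeft) R);
    solve [by []|by rewrite cE nthc|lia].
- move=> f x c pre post cE cf R;
  have sc := szc _ _ _ _ cE; rewrite /= in cE sc.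
  apply: conf_rel_ext (put_id f x.+1) _.
  rewrite [code_len _]/= addn1; apply: (step_instr (m := MRight) R);
    solve [by []|by rewrite cE nthc|lia].
- move=> f x c pre post cE cf R;
  have sc := szc _ _ _ _ cE; rewrite /= in cE sc.
  apply: conf_rel_ext (put_id f x) _.
  rewrite [code_len _]/= addn1; apply: (step_instr (m := MStay) R);
    solve [by []|by rewrite cE nthc|lia].
- move=> s f x c pre post cE cf R;
  have sc := szc _ _ _ _ cE; rewrite /= in cE sc.
  rewrite [code_len _]/= addn1; apply: (step_instr (m := MStay) R);
    solve [by []|by rewrite cE nthc|lia].
- move=> p q f x t g y u h z _ IHp _ IHq c pre post cE cf R;
  have sc := szc _ _ _ _ cE; rewrite /= in cE sc.
  rewrite run_add.
  have R1 := IHp c pre (code q (size pre + code_len p) ++ post) _ cf R.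
  have {}R1 := R1 ltac:(by rewrite cE -catA).
  have := IHq c (pre ++ code p (size pre)) post.
  rewrite size_cat size_code addnA; apply=> //.
  by rewrite cE -!catA.
- move=> b p q f x t g y bx _ IH c pre post cE cf R;
  have sc := szc _ _ _ _ cE; rewrite /= in cE sc.
  set k := size pre in cE R sc *.
  have R1' : conf_rel k.+1 f x (step cf).
  apply: conf_rel_ext (put_id f x) _.
    apply: (step_instr (m := MStay) R) => //.
    + by lia.
    + by rewrite cE /= nthc /branch bx.
    + by lia.
  have -> : t.+2 = 1 + t + 1 by lia.
  rewrite !run_add.
  have {}R1 := IH c (rcons pre (branch b k.+1 (k + code_len p).+2))
    (jump (k + code_len p + code_len q).+2 :: code q (k + code_len p).+2 ++ post).
  rewrite size_rcons -/k in R1.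
  have {}R1 := R1 ltac:(by rewrite cE -cats1 -!catA /= -?catA) _ R1'.
  apply: conf_rel_ext (put_id g y) _.
  have -> : k + (code_len p + code_len q).+2 = (k + code_len p + code_len q).+2 by lia.
  apply: (step_instr (m := MStay) R1) => //.
  + by lia.
  + have -> : k.+1 + code_len p =
       size (pre ++ branch b k.+1 (k + code_len p).+2 :: code p k.+1).
      by rewrite size_cat /= size_code -/k; lia.
    set pp := pre ++ _.
    rewrite (_ : c = pp ++ jump (k + code_len p + code_len q).+2 ::
       code q (k + code_len p).+2 ++ post) ?nthc //.
    by rewrite cE /pp -!catA /= -?catA.
  + by lia.
- move=> b p q f x t g y bx _ IH c pre post cE cf R;
  have sc := szc _ _ _ _ cE; rewrite /= in cE sc.
  set k := size pre in cE R sc *.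
  have R1 : conf_rel (k + code_len p).+2 f x (step cf).
  apply: conf_rel_ext (put_id f x) _.
    apply: (step_instr (m := MStay) R) => //.
    + by lia.
    + by rewrite cE /= nthc /branch bx.
    + by lia.
  rewrite -add1n run_add.
  have -> : k + (code_len p + code_len q).+2 = (k + code_len p).+2 + code_len q by lia.
  pose pp := pre ++ branch b k.+1 (k + code_len p).+2 :: code p k.+1 ++
             [:: jump (k + code_len p + code_len q).+2].
  have sE : size pp = (k + code_len p).+2.
    by rewrite size_cat /= size_cat size_code /= -/k; lia.
  have := IH c pp post; rewrite sE; apply=> //.
  by rewrite cE /pp /= -!catA /= -!catA.
- move=> b p f x bx c pre post cE cf R;
  have sc := szc _ _ _ _ cE; rewrite /= in cE sc.
  set k := size pre in cE R sc *.
  have -> : k + (code_len p).+2 = (k + code_len p).+2 by lia.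
  apply: conf_rel_ext (put_id f x) _.
  apply: (step_instr (m := MStay) R) => //.
  + by lia.
  + by rewrite cE /= nthc /branch bx.
  + by lia.
- move=> b p f x t g y u h z bx _ IH1 _ IH2 c pre post cE cf R;
  have sc := szc _ _ _ _ cE; rewrite /= in cE sc.
  set k := size pre in cE R sc *.
  have R1' : conf_rel k.+1 f x (step cf).
  apply: conf_rel_ext (put_id f x) _.
    apply: (step_instr (m := MStay) R) => //.
    + by lia.
    + by rewrite cE /= nthc /branch bx.
    + by lia.
  have -> : (t + u).+2 = 1 + t + 1 + u by lia.
  rewrite !run_add.
  have {}R1 := IH1 c (rcons pre (branch b k.+1 (k + code_len p).+2)) (jump k :: post).
  rewrite size_rcons -/k in R1.
  have {}R1 := R1 ltac:(by rewrite cE /= -cats1 -!catA /= -?catA) _ R1'.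
  apply: (IH2 c pre post) => //; rewrite -/k.
  apply: conf_rel_ext (put_id g y) _.
  apply: (step_instr (m := MStay) R1) => //.
  + by lia.
  + have -> : k.+1 + code_len p =
       size (pre ++ branch b k.+1 (k + code_len p).+2 :: code p k.+1).
      by rewrite size_cat /= size_code -/k; lia.
    set pp := pre ++ _.
    rewrite (_ : c = pp ++ jump k :: post) ?nthc //.
    by rewrite cE /pp /= -!catA /= -?catA.
  + by lia.
Qed.

Definition tm_of (p : prog) : TM := machine (code p 0).

Lemma run_tm_of p f x t g y (w : seq sym) :
  exec p f x t g y ->
  tape_rel f x [::] (head None w) (behead w) ->
  exists l r, [/\ tape_rel g y l (g y) r,
    halted (run t (init_config (tm_of p) w)) &
    output (run t (init_config (tm_of p) w)) = bin_val (bits_until_blank (g y :: r))].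
Proof.
move=> E T.
have R0 : conf_rel (c := code p 0) 0 f x (init_config (tm_of p) w).
  by case: w T => [|a w] T; split.
have := exec_run E (pre := [::]) (post := [::]) (esym (cats0 _)) R0.
rewrite add0n; case: (run t _) => [[[s l] h] r] /= [sE T1].
exists l, r; case: (T1) => hE _ _; split; [by rewrite -hE| |by rewrite hE].
by rewrite sE size_code.
Qed.

(** * Registers and bit arrays on the tape *)

Definition exec_le p f x T g y := exists2 t, t <= T & exec p f x t g y.

Lemma exec_leW p f x T U g y : T <= U -> exec_le p f x T g y -> exec_le p f x U g y.
Proof. by move=> TU [t tT E]; exists t => //; apply: leq_trans TU. Qed.

Lemma exec_le_seq p q f x T g y U h z :
  exec_le p f x T g y -> exec_le q g y U h z -> exec_le (p ;; q) f x (T + U) h z.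
Proof. by move=> [t tT E] [u uU F]; exists (t + u); [exact: leq_add|exact: ESeq E F]. Qed.

Lemma exec_le_wr s f x : exec_le (Wr s) f x 1 (put f x s) x.
Proof. by exists 1 => //; constructor. Qed.

Lemma exec_le_left f x : exec_le (Mv MLeft) f x 1 f x.+1.
Proof. by exists 1 => //; constructor. Qed.

Lemma exec_le_right f x : exec_le (Mv MRight) f x.+1 1 f x.
Proof. by exists 1 => //; constructor. Qed.

Lemma exec_le_ifc (b : pred sym) p q f x T g y :
  exec_le (if b (f x) then p else q) f x T g y -> exec_le (Ifc b p q) f x T.+2 g y.
Proof.
case bx: (b (f x)) => -[t tT E].
- by exists t.+2; [lia|exact: EIfT].
- by exists t.+1; [lia|exact: EIfF].
Qed.

Lemma exec_le_whlF (b : pred sym) p f x : ~~ b (f x) -> exec_le (Whl b p) f x 1 f x.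
Proof. by move=> /negbTE bx; exists 1 => //; apply: EWhlF. Qed.

Lemma exec_le_whlT (b : pred sym) p f x T g y U h z :
  b (f x) -> exec_le p f x T g y -> exec_le (Whl b p) g y U h z ->
  exec_le (Whl b p) f x (T + U).+2 h z.
Proof.
move=> bx [t tT E] [u uU F]; exists (t + u).+2; first by rewrite !ltnS leq_add.
exact: EWhlT E F.
Qed.

Fixpoint mvl k := if k is k'.+1 then Mv MLeft ;; mvl k' else Nop.
Fixpoint mvr k := if k is k'.+1 then Mv MRight ;; mvr k' else Nop.

Lemma exec_le_mvl k f x : exec_le (mvl k) f x k f (x + k).
Proof.
elim: k x => [|k IH] x /=; first by rewrite addn0; exists 0 => //; constructor.
by rewrite -addSnnS -add1n; apply: exec_le_seq (IH _); apply: exec_le_left.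
Qed.

Lemma exec_le_mvr k f x : exec_le (mvr k) f (x + k) k f x.
Proof.
elim: k x => [|k IH] x /=; first by rewrite addn0; exists 0 => //; constructor.
by rewrite -{2}add1n addnS; apply: exec_le_seq (IH _); apply: exec_le_right.
Qed.

Definition mvto a b := if a <= b then mvl (b - a) else mvr (a - b).

Lemma exec_le_mvto a b c f x : a <= c -> b <= c ->
  exec_le (mvto a b) f (x + a) c f (x + b).
Proof.
move=> ac bc; rewrite /mvto; case: leqP => ab.
- have := exec_le_mvl (b - a) f (x + a); rewrite -addnA subnKC // => E.
  by apply: exec_leW E; lia.
- have := exec_le_mvr (a - b) f (x + b); rewrite -addnA subnKC; last exact: ltnW.
  by apply: exec_leW; lia.
Qed.

(** With the number of tracks as stride, such a walk stays on one track and visits one cell per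
    block. *)
Lemma walk_left (b : pred sym) d f k x :
  (forall i, i < k -> b (f (x + i * d))) -> ~~ b (f (x + k * d)) ->
  exec_le (Whl b (mvl d)) f x (k * d.+2).+1 f (x + k * d).
Proof.
elim: k x => [|k IH] x bi bk; first by rewrite mul0n addn0 in bk *; apply: exec_le_whlF.
have bx : b (f x) by have := bi 0 isT; rewrite mul0n addn0.
rewrite mulSn addnA in bk *.
apply: exec_leW (exec_le_whlT bx (exec_le_mvl _ _ _) (IH (x + d) _ bk)).
  by rewrite mulSn; lia.
by move=> i ik; have := bi i.+1 ik; rewrite mulSn addnA.
Qed.

Lemma walk_left1 (b : pred sym) f k x :
  (forall y, x <= y < x + k -> b (f y)) -> ~~ b (f (x + k)) ->
  exec_le (Whl b (Mv MLeft)) f x (k * 3).+1 f (x + k).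
Proof.
elim: k x => [|k IH] x bi bk; first by rewrite addn0 in bk *; apply: exec_le_whlF.
rewrite -addSnnS in bk *.
have bx : b (f x) by apply: bi; lia.
apply: exec_leW (exec_le_whlT bx (exec_le_left _ _) (IH _ _ bk)); first by lia.
by move=> y xy; apply: bi; lia.
Qed.

Lemma walk_right (b : pred sym) f k x :
  (forall y, x < y <= x + k -> b (f y)) -> ~~ b (f x) ->
  exec_le (Whl b (Mv MRight)) f (x + k) (k * 3).+1 f x.
Proof.
elim: k => [|k IH] bi bk; first by rewrite addn0; apply: exec_le_whlF.
rewrite addnS.
have bx : b (f (x + k).+1) by apply: bi; lia.
apply: exec_leW (exec_le_whlT bx (exec_le_right _ _) (IH _ bk)); first by lia.
by move=> y xy; apply: bi; lia.
Qed.

Fixpoint wrs (l : seq sym) := if l is a :: l' then Wr a ;; Mv MLeft ;; wrs l' else Nop.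
Fixpoint puts f x (l : seq sym) := if l is a :: l' then puts (put f x a) x.+1 l' else f.

Lemma putsE f x l y :
  puts f x l y = if x <= y < x + size l then nth None l (y - x) else f y.
Proof.
elim: l f x => [|a l IH] f x /=; first by rewrite addn0; case: ifP => //; lia.
rewrite IH /put; case: ifP => [xy|].
  by rewrite ifT; [rewrite (_ : y - x = (y - x.+1).+1) //; lia|lia].
case: eqP => [->|xy] h; first by rewrite leqnn addnS ltnS leq_addr subnn.
by rewrite ifF //; lia.
Qed.

Lemma exec_le_wrs l f x : exec_le (wrs l) f x (2 * size l) (puts f x l) (x + size l).
Proof.
elim: l f x => [|a l IH] f x /=; first by rewrite addn0; exists 0 => //; constructor.
rewrite mulnS -addSnnS -[2]/(1 + 1) -addnA; apply: exec_le_seq (exec_le_wr _ _ _) _.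
by apply: exec_le_seq (exec_le_left _ _) (IH _ _).
Qed.

(* Working storage: tracks [0 .. nreg-1] are registers, a register holding [p] being a track
   whose only mark is in block [p]; tracks [nreg .. ntrk-1] are bit arrays. *)
Definition nreg := 30.
Definition ntrk := 40.

Record store := Store { reg : nat -> nat; arr : nat -> nat -> bool; out : nat }.

Definition track s t p := if t < nreg then p == reg s t else arr s t p.

(** The tracks are interleaved: a block holds one cell of every track, so that the mark of a
    register leads directly to the same position of any other track. *)
Definition cell m p t := m.+2 + p * ntrk + t.

(* [m] cells on the right of the blank home cell [m.+1] hold [out] in binary; [e] blocks of
   working storage have been initialised on its left. *)
Record rep (m e : nat) (s : store) (f : nat -> sym) : Prop := Rep {
  rep_reg : forall r, r < nreg -> reg s r < e;
  rep_arr : forall t p, e <= p -> arr s t p = false;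
  rep_cell : forall p t, p < e -> t < ntrk -> f (cell m p t) = Some (track s t p);
  rep_end : forall x, cell m e 0 <= x -> f x = None;
  rep_home : f m.+1 = None;
  rep_zero : f 0 = None;
  rep_out : forall i, i < m -> f i.+1 = Some (odd (out s %/ 2 ^ i)) }.

(** A generous bound for one elementary instruction, which makes a constant number of sweeps over
    the m + 2 + 40 e cells in use. *)
Definition tick m e := 2000 * (m + e + 3).

(** The same D bounds the number of instructions and the number of new blocks. Charging every
    instruction for the final length of the tape makes these bounds additive under composition. *)
Definition sim (P : prog) s D s' := forall m e f, rep m e s f ->
  exists f' e', [/\ rep m e' s' f', e' <= e + D &
    exec_le P f m.+1 (D * tick m (e + D)) f' m.+1].

Lemma sim_seq P Q s s' s'' D D' : sim P s D s' -> sim Q s' D' s'' ->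
  sim (P ;; Q) s (D + D') s''.
Proof.
move=> simP simQ m e f /simP[f1 [e1 [R1 E1 X1]]].
have [f2 [e2 [R2 E2 X2]]] := simQ _ _ _ R1; exists f2, e2; split=> //; first by lia.
refine (exec_leW _ (exec_le_seq X1 X2)); rewrite mulnDl leq_add // leq_mul //.
- by rewrite /tick; lia.
- by rewrite /tick; lia.
Qed.

Lemma simW P s D D' s' : D <= D' -> sim P s D s' -> sim P s D' s'.
Proof.
move=> DD simP m e f /simP[f1 [e1 [R1 E1 X1]]]; exists f1, e1; split=> //; first by lia.
by apply: exec_leW X1; rewrite leq_mul // /tick; lia.
Qed.

Definition home := Whl (fun a => a != None) (Mv MRight).
(** A register is used as an address: from the home cell the head strides along track r until it
    meets the mark, then shifts to track t within the same block. *)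
Definition look r t := mvl r.+1 ;; Whl (fun a => a == Some false) (mvl ntrk) ;; mvto r t.

(** Stated for a bare tape instead of [rep], because a copy erases the mark of its target before it
    looks up the source, and in between the target register has no value. *)
Lemma exec_look m e f r t v : r < nreg -> t < ntrk -> v < e ->
  (forall p, p <= v -> f (cell m p r) = Some (p == v)) ->
  exec_le (look r t) f m.+1 (50 * (m + e + 3)) f (cell m v t).
Proof.
move=> rr tt ve fE.
have rt : r < ntrk by rewrite /nreg /ntrk in rr *; lia.
have cE p : m.+1 + r.+1 + p * ntrk = cell m p r by rewrite /cell; lia.
refine (exec_leW _ (exec_le_seq (exec_le_mvl _ _ _) (exec_le_seq (walk_left (k := v) _ _)
   (_ : exec_le (mvto r t) _ _ ntrk _ _)))).
- by rewrite /nreg /ntrk in rr *; lia.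
- by move=> i ir; rewrite cE fE ?ltn_eqF // ltnW.
- by rewrite cE fE // eqxx.
- by rewrite cE /cell; apply: exec_le_mvto; apply: ltnW.
Qed.

Lemma exec_home m e f p t : f m.+1 = None ->
  (forall q u, q < e -> u < ntrk -> f (cell m q u) != None) -> p < e -> t < ntrk ->
  exec_le home f (cell m p t) (130 * (m + e + 3)) f m.+1.
Proof.
move=> f0 fS pe tt.
have -> : cell m p t = m.+1 + (p * ntrk + t).+1 by rewrite /cell; lia.
apply: exec_leW (walk_right _ _); rewrite ?f0 //.
  by rewrite /ntrk in tt *; lia.
move=> y xy; have -> : y = cell m ((y - m.+2) %/ ntrk) ((y - m.+2) %% ntrk).
  by rewrite /cell -addnA -divn_eq; lia.
apply: fS; rewrite ?ltn_pmod //.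
by rewrite ltn_divLR //; rewrite /ntrk in tt xy *; lia.
Qed.

Lemma rep_look m e s f r t : rep m e s f -> r < nreg -> t < ntrk ->
  exec_le (look r t) f m.+1 (50 * (m + e + 3)) f (cell m (reg s r) t).
Proof.
move=> Rp rr tt; have re := rep_reg Rp rr; apply: exec_look => // p pr.
rewrite (rep_cell Rp) /track ?rr //; first by lia.
by rewrite /nreg /ntrk in rr *; lia.
Qed.

Lemma rep_go_home m e s f p t : rep m e s f -> p < e -> t < ntrk ->
  exec_le home f (cell m p t) (130 * (m + e + 3)) f m.+1.
Proof.
move=> Rp; apply: exec_home; first exact: (rep_home Rp).
by move=> q u qe ut; rewrite (rep_cell Rp).
Qed.

Lemma cell_inj m p t q u : t < ntrk -> u < ntrk -> (cell m p t == cell m q u) = (p == q) && (t == u).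
Proof. by rewrite /cell /ntrk => tt uu; apply/idP/idP => [/eqP|]; lia. Qed.

Definition setR r v s := Store (fun x => if x == r then v else reg s x) (arr s) (out s).
Definition setA t p b s :=
  Store (reg s) (fun u q => if (u == t) && (q == p) then b else arr s u q) (out s).
Definition incO s := Store (reg s) (arr s) (out s).+1.

Lemma rep_put m e s s' f p t b : rep m e s f -> p < e -> t < ntrk ->
  (forall r, r < nreg -> reg s' r < e) ->
  (forall u q, e <= q -> arr s' u q = false) -> out s' = out s ->
  (forall q u, q < e -> u < ntrk ->
     track s' u q = if (q == p) && (u == t) then b else track s u q) ->
  rep m e s' (put f (cell m p t) (Some b)).
Proof.
move=> Rp pe tt rE aE oE tE.
have ne x : x < m.+2 -> x == cell m p t = false by rewrite /cell; lia.
split=> //.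
- move=> q u qe uu; rewrite /put cell_inj // tE //; case: ifP => // _.
  exact: (rep_cell Rp).
- move=> x xe; rewrite /put ifF ?(rep_end Rp) //.
  by move: xe; rewrite /cell /ntrk in tt *; lia.
- by rewrite /put ne ?(rep_home Rp).
- by rewrite /put ne ?(rep_zero Rp).
- by move=> i im; rewrite /put ne ?(rep_out Rp) ?oE //; lia.
Qed.

Definition set_prog r t b := look r t ;; Wr (Some b) ;; home.

Lemma sim_set s r t b : r < nreg -> nreg <= t < ntrk ->
  sim (set_prog r t b) s 1 (setA t (reg s r) b s).
Proof.
move=> rr /andP[nt tt] m e f Rp.
have re := rep_reg Rp rr.
have Rp' : rep m e (setA t (reg s r) b s) (put f (cell m (reg s r) t) (Some b)).
  apply: (rep_put Rp) => //=.
  - exact: (rep_reg Rp).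
  - move=> u q eq; case: ifP => [/andP[_ /eqP qE]|_]; last exact: (rep_arr Rp).
    by move: eq; rewrite qE leqNgt re.
  - move=> q u qe uu; rewrite /track /= andbC; case: ltnP => // un.
    by rewrite (_ : u == t = false) ?andbF //; lia.
exists (put f (cell m (reg s r) t) (Some b)), e; split=> //; first by lia.
refine (exec_leW _ (exec_le_seq (rep_look Rp rr tt)
  (exec_le_seq (exec_le_wr _ _ _) (rep_go_home Rp' re tt)))).
by rewrite /tick; lia.
Qed.

Definition copy_prog r r' := look r r ;; Wr (Some false) ;; home ;; look r' r ;; Wr (Some true) ;; home.

Lemma sim_copy s r r' : r < nreg -> r' < nreg -> r != r' ->
  sim (copy_prog r r') s 1 (setR r (reg s r') s).
Proof.
move=> rr rr' nrr m e f Rp.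
have re := rep_reg Rp rr; have re' := rep_reg Rp rr'.
have rt : r < ntrk by rewrite /nreg /ntrk in rr *; lia.
have rt' : r' < ntrk by rewrite /nreg /ntrk in rr' *; lia.
set f1 := put f (cell m (reg s r) r) (Some false).
set f2 := put f1 (cell m (reg s r') r) (Some true).
have cne x p : x < m.+2 -> (x == cell m p r) = false by rewrite /cell; lia.
have f1E q u : q < e -> u < ntrk ->
    f1 (cell m q u) = Some ((u != r) && track s u q).
  move=> qe ut; rewrite /f1 /put cell_inj // (rep_cell Rp) //.
  by case: (eqVneq u r) => [-> | _]; rewrite ?andbT ?andbF //= /track rr; case: eqP.
have Rp2 : rep m e (setR r (reg s r') s) f2.
  split.
  - by move=> u un /=; case: ifP => // _; apply: (rep_reg Rp).
  - exact: (rep_arr Rp).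
  - move=> p t pe tt; rewrite /f2 /put cell_inj // f1E // /track /=.
    case: (eqVneq t r) => [-> | tr]; rewrite ?andbF //= andbT rr.
    by case: eqP.
  - move=> x xe; rewrite /f2 /f1 /put !ifF ?(rep_end Rp) //.
    + by move: xe; rewrite /cell /ntrk in rt *; lia.
    + by move: xe; rewrite /cell /ntrk in rt *; lia.
  - by rewrite /f2 /f1 /put !cne // (rep_home Rp).
  - by rewrite /f2 /f1 /put !cne // (rep_zero Rp).
  - by move=> i im; rewrite /f2 /f1 /put !cne ?(rep_out Rp) //; lia.
exists f2, e; split=> //; first by lia.
refine (exec_leW _ (exec_le_seq (rep_look Rp rr rt) (exec_le_seq (exec_le_wr _ _ _)
  (exec_le_seq (exec_home (e := e) _ _ re rt)
  (exec_le_seq (exec_look (r := r') (e := e) (v := reg s r') _ _ _ _) (exec_le_seq (exec_le_wr _ _ _)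
  (rep_go_home Rp2 re' rt))))))) => //.
- by rewrite /tick; lia.
- by rewrite /f1 /put cne // (rep_home Rp).
- by move=> q u qe ut; rewrite -/f1 f1E.
- move=> p pr; rewrite -/f1 f1E ?rt' //; last by lia.
  by rewrite eq_sym nrr /track rr'.
Qed.

(** A blank cell one block further means that the next block has not been initialised. It is then
    filled with [Some false] on all tracks, which agrees with the store: no other register points
    there and all arrays are false there. *)
Definition inc_prog r :=
  look r r ;; Wr (Some false) ;; mvl ntrk ;;
  Ifc (fun a => a == None) (mvr r ;; wrs (nseq ntrk (Some false)) ;; mvr (ntrk - r)) Nop ;;
  Wr (Some true) ;; home.

Lemma sim_inc s r : r < nreg -> sim (inc_prog r) s 1 (setR r (reg s r).+1 s).
Proof.
move=> rr m e f Rp.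
have re := rep_reg Rp rr.
have rt : r < ntrk by rewrite /nreg /ntrk in rr *; lia.
set p := reg s r.
set f1 := put f (cell m p r) (Some false).
have cne x q : x < m.+2 -> (x == cell m q r) = false by rewrite /cell; lia.
have f1E q u : q < e -> u < ntrk ->
    f1 (cell m q u) = Some ((u != r) && track s u q).
  move=> qe ut; rewrite /f1 /put cell_inj // (rep_cell Rp) //.
  by case: (eqVneq u r) => [-> | _]; rewrite ?andbT ?andbF //= /track rr; case: eqP.
pose e' := maxn e p.+2.
pose g := if p.+1 < e then f1 else puts f1 (cell m p.+1 0) (nseq ntrk (Some false)).
have gE q u : q < e' -> u < ntrk -> g (cell m q u) = Some ((u != r) && track s u q).
  move=> qe ut; rewrite /g; case: ltnP => pe.
    by apply: f1E => //; rewrite /e' in qe; lia.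
  have {}pe : p.+1 = e by lia.
  rewrite putsE size_nseq pe; case: ifP => qE.
    have -> : q = e by move: qE; rewrite /cell /ntrk in ut *; lia.
    rewrite nth_nseq ifT; last by rewrite /cell; lia.
    rewrite /track; case: ltnP => un; last by rewrite (rep_arr Rp) ?andbF.
    by rewrite (gtn_eqF (rep_reg Rp un)) andbF.
  by apply: f1E => //; move: qE; rewrite /e' /cell /ntrk in qe ut *; lia.
have gL x : x < m.+2 -> g x = f x.
  move=> xm; rewrite /g; case: ifP => _; last rewrite putsE ifF.
  - by rewrite /f1 /put cne.
  - by rewrite /f1 /put cne.
  - by rewrite /cell; lia.
have gR x : cell m e' 0 <= x -> g x = None.
  move=> xe; have f1x : f1 x = None.
    rewrite /f1 /put ifF ?(rep_end Rp) //.
      by move: xe; rewrite /cell /e' /ntrk in rt *; lia.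
    by move: xe; rewrite /cell /e' /ntrk in rt *; lia.
  rewrite /g; case: ltnP => _ //; rewrite putsE size_nseq ifF //.
  by move: xe; rewrite /cell /e' /ntrk; lia.
set f2 := put g (cell m p.+1 r) (Some true).
have pe' : p.+1 < e' by rewrite /e'; lia.
have ee' : e <= e' by rewrite /e'; lia.
have Rp2 : rep m e' (setR r p.+1 s) f2.
  split.
  - move=> u un /=; case: ifP => // _; apply: leq_trans (rep_reg Rp un) _.
    by rewrite /e'; lia.
  - by move=> t q eq; apply: (rep_arr Rp); lia.
  - move=> q t qe tt; rewrite /f2 /put cell_inj // gE // /track /=.
    case: (eqVneq t r) => [-> | tr]; rewrite ?andbF //= andbT rr.
    by case: eqP.
  - move=> x xe; rewrite /f2 /put ifF ?gR //.
    by move: xe; rewrite /cell /ntrk in rt *; lia.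
  - by rewrite /f2 /put cne // gL ?(rep_home Rp).
  - by rewrite /f2 /put cne // gL ?(rep_zero Rp).
  - by move=> i im; rewrite /f2 /put cne ?gL ?(rep_out Rp) //; lia.
exists f2, e'; split=> //; first by rewrite /e'; lia.
have cS : cell m p r + ntrk = cell m p.+1 r by rewrite /cell; lia.
have X3 : exec_le (Ifc (fun a => a == None)
    (mvr r ;; wrs (nseq ntrk (Some false)) ;; mvr (ntrk - r)) Nop)
    f1 (cell m p.+1 r) (r + (2 * ntrk + ntrk)).+2 g (cell m p.+1 r).
  apply: exec_le_ifc; case: (ltnP p.+1 e) => pe.
    by rewrite f1E //=; exists 0 => //; rewrite /g pe; constructor.
  have {}pe : p.+1 = e by lia.
  have -> : f1 (cell m p.+1 r) = None.
    rewrite /f1 /put cell_inj // ifF ?(rep_end Rp) //.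
      by rewrite pe /cell; lia.
    by rewrite gtn_eqF.
  rewrite eqxx; have -> : cell m p.+1 r = cell m p.+1 0 + r by rewrite /cell addn0.
  apply: exec_le_seq (exec_le_mvr _ _ _) _.
  have X := exec_le_wrs (nseq ntrk (Some false)) f1 (cell m p.+1 0).
  rewrite size_nseq in X; apply: exec_le_seq X _.
  rewrite (_ : _ + ntrk = cell m p.+1 0 + r + (ntrk - r)); last by lia.
  have := exec_le_mvr (ntrk - r) g (cell m p.+1 0 + r).
  by rewrite {1}/g ltnNge pe leqnn /=; apply: exec_leW; lia.
have X4 := exec_le_mvl ntrk f1 (cell m p r); rewrite cS in X4.
refine (exec_leW _ (exec_le_seq (rep_look Rp rr rt) (exec_le_seq (exec_le_wr _ _ _)
  (exec_le_seq X4 (exec_le_seq X3 (exec_le_seq (exec_le_wr _ _ _) (rep_go_home Rp2 pe' rt))))))).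
by rewrite /tick /e' /ntrk in rt re *; lia.
Qed.

(** * Binary increment of the output *)

Definition bit o i := odd (o %/ 2 ^ i).

Lemma bit0S o : bit o 0 = odd o. Proof. by rewrite /bit divn1. Qed.

Lemma bitS o i : bit o i.+1 = bit o./2 i.
Proof. by rewrite /bit expnS -divn2 divnMA. Qed.

Lemma bit_incr k o : (forall i, i < k -> bit o i) ->
  [/\ forall i, i < k -> bit o.+1 i = false,
      ~~ bit o k -> bit o.+1 k &
      ~~ bit o k -> forall i, k < i -> bit o.+1 i = bit o i].
Proof.
elim: k o => [|k IH] o ok.
  split=> //; rewrite !bit0S /=; first by [].
  by move=> /negbTE o0 [|i] // _; rewrite !bitS -uphalfE uphalf_half o0.
have o1 : odd o by have := ok 0 isT; rewrite bit0S.
have oS : o.+1./2 = o./2.+1 by rewrite -uphalfE uphalf_half o1.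
have [|h1 h2 h3] := IH o./2; first by move=> i ik; rewrite -bitS ok.
rewrite !bitS oS; split=> //.
- by case=> [|i] ik; rewrite ?bitS ?oS ?h1 // bit0S /= o1.
- by move=> hk [|i] // ik; rewrite !bitS oS h3.
Qed.

Lemma lowest_zero (p : pred nat) m :
  exists k, [/\ k <= m, forall i, i < k -> p i & k < m -> ~~ p k].
Proof.
elim: m => [|m [k [km pk nk]]]; first by exists 0.
have [km'|km'] := ltnP k m; first by exists k; split=> //; rewrite ?nk // ltnW.
have {km km'}E : k = m by lia.
case pm: (p m); last by exists m; split=> // [i im|]; [apply: pk; rewrite E|rewrite pm].
exists m.+1; split=> // [i|]; last by rewrite ltnn.
by rewrite ltnS leq_eqVlt => /predU1P[-> //|im]; apply: pk; rewrite E.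
Qed.

Lemma fill_loop (b : pred sym) k f x :
  (forall i, i < k -> b (f (x + i))) -> ~~ b (f (x + k)) ->
  exec_le (Whl b (Wr (Some false) ;; Mv MLeft)) f x
    (k * 4).+1 (puts f x (nseq k (Some false))) (x + k).
Proof.
elim: k f x => [|k IH] f x fi fk; first by rewrite addn0 in fk *; apply: exec_le_whlF.
have fx : b (f x) by rewrite -(addn0 x) fi.
rewrite -addSnnS in fk *; have ne y : x < y -> put f x (Some false) y = f y.
  by move=> xy; rewrite /put gtn_eqF.
refine (exec_leW _ (exec_le_whlT (b := b) fx (exec_le_seq (exec_le_wr _ _ _) (exec_le_left _ _))
  (IH _ _ _ _))); first by lia.
- by move=> i ik; rewrite ne ?addSnnS ?fi //; lia.
- by rewrite ne //; lia.
Qed.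

Definition out_prog :=
  Mv MRight ;; Whl (fun a => a != None) (Mv MRight) ;; Mv MLeft ;;
  Whl (fun a => a == Some true) (Wr (Some false) ;; Mv MLeft) ;;
  Ifc (fun a => a == None) Nop (Wr (Some true)) ;;
  Whl (fun a => a != None) (Mv MLeft).

(** The increment flips the lowest zero, at index k, and the ones below it. [rep_out] speaks of the
    m lowest bits only, so the overflow from all ones to all zeros, the case k = m, is a correct
    increment modulo 2^m. *)
Lemma sim_out s : sim out_prog s 1 (incO s).
Proof.
move=> m e f Rp.
have fO i : i < m -> f i.+1 = Some (bit (out s) i) := @rep_out _ _ _ _ Rp i.
have [k [km bk nk]] := lowest_zero (bit (out s)) m.
have [b1 b2 b3] := bit_incr bk.
set f1 := puts f 1 (nseq k (Some false)).
have f1E x : f1 x = if 0 < x <= k then Some false else f x.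
  rewrite /f1 putsE size_nseq add1n ltnS; case: ifP => // xk.
  by rewrite nth_nseq ifT //; lia.
have fk : k < m -> f k.+1 = Some false by move=> ik; rewrite fO // (negbTE (nk ik)).
pose g := if k == m then f1 else put f1 k.+1 (Some true).
have gE x : m < x \/ x = 0 -> g x = f x.
  move=> xm; have f1x : f1 x = f x by rewrite f1E; case: ifP => //; case: xm => ?; lia.
  rewrite /g; case: eqP => // kNm; rewrite /put; case: eqP => //; case: xm => ?; lia.
have gO i : i < m -> g i.+1 = Some (bit (out s).+1 i).
  move=> im; rewrite /g; case: eqP => [E | kNm].
    by rewrite f1E E im b1 // E.
  have {kNm}km' : k < m by lia.
  rewrite /put eqSS f1E /=; case: (ltngtP i k) => ik.
  - by rewrite b1.
  - by rewrite b3 ?nk // fO.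
  - by rewrite ik b2 // nk.
have Rp2 : rep m e (incO s) g.
  split.
  - exact: (rep_reg Rp).
  - exact: (rep_arr Rp).
  - by move=> p t pe tt; rewrite gE ?(rep_cell Rp) //; left; rewrite /cell; lia.
  - by move=> x xe; rewrite gE ?(rep_end Rp) //; left; move: xe; rewrite /cell; lia.
  - by rewrite gE ?(rep_home Rp) //; left.
  - by rewrite gE ?(rep_zero Rp) //; right.
  - exact: gO.
exists g, e; split=> //; first by lia.
have X1 : exec_le (Whl (fun a => a != None) (Mv MRight)) f m (m * 3).+1 f 0.
  apply: (walk_right (x := 0)) => [y ym|]; last by rewrite (rep_zero Rp).
  by rewrite -(prednK (n := y)) ?fO //; lia.
have X2 : exec_le (Ifc (fun a => a == None) Nop (Wr (Some true))) f1 k.+1 3 g k.+1.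
  apply: exec_le_ifc; rewrite f1E ltnn andbF /g; case: (k =P m) => [E | kNm].
    by rewrite E (rep_home Rp) /=; exists 0 => //; constructor.
  by rewrite fk; [apply: exec_le_wr|lia].
have X3 : exec_le (Whl (fun a => a != None) (Mv MLeft)) g k.+1 (m * 3).+1 g m.+1.
  have -> : m.+1 = k.+1 + (m - k) by lia.
  refine (exec_leW _ (walk_left1 _ _)); first by lia.
    by move=> y ky; rewrite -(prednK (n := y)) ?gO //; lia.
  by rewrite (_ : k.+1 + (m - k) = m.+1) ?(rep_home Rp2) //; lia.
have X4 := fill_loop (b := fun a => a == Some true) (k := k) (f := f) (x := 1); rewrite -/f1 add1n in X4.
refine (exec_leW _ (exec_le_seq (exec_le_right _ _) (exec_le_seq X1
  (exec_le_seq (exec_le_left _ _) (exec_le_seq (X4 _ _) (exec_le_seq X2 X3)))))).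
- by rewrite /tick; lia.
- by move=> i ik; rewrite add1n fO ?bk //; lia.
- have [/fk -> //|mk] := ltnP k m.
  by have -> : k = m by [lia]; rewrite (rep_home Rp).
Qed.

Definition test (b : bool) : pred sym := fun a => a == Some b.

Definition if_prog r t P Q := look r t ;; Ifc (test true) (home ;; P) (home ;; Q).
Definition while_prog b r t P :=
  look r t ;; Whl (test b) (home ;; P ;; look r t) ;; home.

(** One test serves two purposes: on an array track it reads a bit, on a register track it compares
    two registers for equality. *)
Definition cond s r t := track s t (reg s r).

Lemma sim_if s r t P Q D s' : r < nreg -> t < ntrk ->
  (cond s r t -> sim P s D s') -> (~~ cond s r t -> sim Q s D s') ->
  sim (if_prog r t P Q) s D.+1 s'.
Proof.
move=> rr tt simP simQ m e f Rp.
have re := rep_reg Rp rr.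
have X1 := rep_look Rp rr tt; have X2 := rep_go_home Rp re tt.
have [f' [e' [R' E' X3]]] : exists f' e', [/\ rep m e' s' f', e' <= e + D &
    exec_le (if cond s r t then P else Q) f m.+1 (D * tick m (e + D)) f' m.+1].
  by case: (boolP (cond s r t)) => c; [apply: simP c _ _ _ Rp|apply: simQ c _ _ _ Rp].
exists f', e'; split=> //; first by lia.
have X4 : exec_le (Ifc (test true) (home ;; P) (home ;; Q)) f (cell m (reg s r) t)
    (130 * (m + e + 3) + D * tick m (e + D)).+2 f' m.+1.
  apply: exec_le_ifc; rewrite (rep_cell Rp) // -/(cond s r t) /test.
  by move: X3; case: (cond s r t) => X3; apply: exec_le_seq X2 X3.
refine (exec_leW _ (exec_le_seq X1 X4)).
rewrite (mulSn D); have : D * tick m (e + D) <= D * tick m (e + D.+1).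
  by rewrite leq_mul // /tick; lia.
by move=> h; rewrite [X in _ <= X + _]/tick; lia.
Qed.

Lemma sim_while b r t P D k (S : nat -> store) : r < nreg -> t < ntrk ->
  (forall j, j < k -> cond (S j) r t = b /\ sim P (S j) D (S j.+1)) ->
  cond (S k) r t = ~~ b ->
  sim (while_prog b r t P) (S 0) (k * D.+1).+1 (S k).
Proof.
move=> rr tt body stop m e f Rp.
(* Strip the first [look] and the last [home]: between two rounds the head rests on the tested
   cell. *)
suff [f' [e' [R' E' X]]] : exists f' e', [/\ rep m e' (S k) f', e' <= e + k * D &
    exec_le (Whl (test b) (home ;; P ;; look r t)) f (cell m (reg (S 0) r) t)
      (k * D.+1 * tick m (e + k * D)).+1 f' (cell m (reg (S k) r) t)].
  exists f', e'; split=> //; first by lia.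
  refine (exec_leW _ (exec_le_seq (rep_look Rp rr tt)
    (exec_le_seq X (rep_go_home R' (rep_reg R' rr) tt)))).
  rewrite (mulSn (k * D.+1)); have : k * D.+1 * tick m (e + k * D) <=
      k * D.+1 * tick m (e + (k * D.+1).+1) by rewrite leq_mul // /tick; lia.
  by move=> h; rewrite [X in _ <= X + _]/tick; lia.
elim: k S e f Rp body stop => [|k IH] S e f Rp body stop.
  exists f, e; split=> //; first by lia.
  by apply: exec_le_whlF; rewrite (rep_cell Rp) ?(rep_reg Rp) // -/(cond _ _ _) stop /test; case: (b).
have [c0 simP] := body 0 isT.
have [f1 [e1 [R1 E1 X1]]] := simP _ _ _ Rp.
have [|//|f2 [e2 [R2 E2 X2]]] := IH (fun j => S j.+1) _ _ R1.
  by move=> j jk; apply: body.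
exists f2, e2; split=> //; first by lia.
refine (exec_leW _ (exec_le_whlT _ (exec_le_seq (rep_go_home Rp (rep_reg Rp rr) tt)
  (exec_le_seq X1 (rep_look R1 rr tt))) X2)); last first.
  by rewrite (rep_cell Rp) ?(rep_reg Rp) // -/(cond _ _ _) c0 /test.
set E := e + k.+1 * D.
have : D * tick m (e + D) <= D * tick m E by rewrite leq_mul // /tick /E; lia.
have : k * D.+1 * tick m (e1 + k * D) <= k * D.+1 * tick m E.
  by rewrite leq_mul // /tick /E; lia.
have : 50 * (m + e1 + 3) + 130 * (m + e + 3) + 10 <= tick m E.
  by rewrite /tick /E; lia.
have -> : k.+1 * D.+1 * tick m E = k * D.+1 * tick m E + (D * tick m E + tick m E).
  by rewrite (mulSn k) mulnDl (mulSn D); lia.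
by lia.
Qed.

(** * A loop language *)

(* Register 0 always holds 0 and register 1 is the bound of all loops. *)
Inductive cmd :=
| Cnop
| Cset of nat & nat & bool
| Ccopy of nat & nat
| Cinc of nat
| Cout
| Cseq of cmd & cmd
| Cif of nat & nat & cmd & cmd
| Cfor of nat & cmd.

Notation "c ;+ d" := (Cseq c d) (at level 60, right associativity).

Definition incR r s := setR r (reg s r).+1 s.

Fixpoint eval c s :=
  match c with
  | Cnop => s
  | Cset r t b => setA t (reg s r) b s
  | Ccopy r r' => setR r (reg s r') s
  | Cinc r => incR r s
  | Cout => incO s
  | Cseq c d => eval d (eval c s)
  | Cif r t c d => if cond s r t then eval c s else eval d s
  | Cfor i c => iter (reg s 1) (fun s => incR i (eval c s)) (setR i 0 s)
  end.

(** These syntactic frame conditions are decided by computation, which settles nearly all side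
    conditions about concrete programs. *)
Fixpoint modR r c :=
  match c with
  | Ccopy r' _ | Cinc r' => r == r'
  | Cseq c d | Cif _ _ c d => modR r c || modR r d
  | Cfor i c => (r == i) || modR r c
  | _ => false
  end.

Fixpoint modA t c :=
  match c with
  | Cset _ t' _ => t == t'
  | Cseq c d | Cif _ _ c d => modA t c || modA t d
  | Cfor _ c => modA t c
  | _ => false
  end.

Fixpoint modO c :=
  match c with
  | Cout => true
  | Cseq c d | Cif _ _ c d => modO c || modO d
  | Cfor _ c => modO c
  | _ => false
  end.

(** The conditions [1 < r] and [1 < i] protect registers 0 and 1. Hence the loop bound never changes
    and [cost] is a function of it alone. *)
Fixpoint wf c :=
  match c with
  | Cnop | Cout => true
  | Cset r t _ => (r < nreg) && (nreg <= t < ntrk)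
  | Ccopy r r' => [&& 1 < r, r < nreg, r' < nreg & r != r']
  | Cinc r => 1 < r < nreg
  | Cseq c d => wf c && wf d
  | Cif r t c d => [&& r < nreg, t < ntrk, wf c & wf d]
  | Cfor i c => [&& 1 < i, i < nreg, wf c & ~~ modR i c]
  end.

Fixpoint cost c n :=
  match c with
  | Cnop => 0
  | Cset _ _ _ | Ccopy _ _ | Cinc _ | Cout => 1
  | Cseq c d => cost c n + cost d n
  | Cif _ _ c d => (cost c n + cost d n).+1
  | Cfor i c => (n * (cost c n + 2)).+2
  end.

(** A counter i is reset by copying register 0. Its loop goes on while track i has no mark at the
    position given by register 1, that is, while i differs from the bound. *)
Fixpoint compile c :=
  match c with
  | Cnop => Nop
  | Cset r t b => set_prog r t b
  | Ccopy r r' => copy_prog r r'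
  | Cinc r => inc_prog r
  | Cout => out_prog
  | Cseq c d => compile c ;; compile d
  | Cif r t c d => if_prog r t (compile c) (compile d)
  | Cfor i c => copy_prog i 0 ;; while_prog false 1 i (compile c ;; inc_prog i)
  end.

Lemma eval_reg r c s : ~~ modR r c -> reg (eval c s) r = reg s r.
Proof.
elim: c s => //= [r' r''|r'|c IHc d IHd|r' t c IHc d IHd|i c IHc] s.
- by move=> /negbTE ->.
- by move=> /negbTE ->.
- by rewrite negb_or => /andP[hc hd]; rewrite IHd ?IHc.
- by rewrite negb_or => /andP[hc hd]; case: ifP => _; rewrite ?IHd ?IHc.
- rewrite negb_or => /andP[ri hc]; elim: (reg s 1) => [|k IH] /=.
    by rewrite (negbTE ri).
  by rewrite (negbTE ri) IHc.
Qed.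

Lemma eval_arr t c s p : ~~ modA t c -> arr (eval c s) t p = arr s t p.
Proof.
elim: c s => //= [r' t' b|c IHc d IHd|r' t' c IHc d IHd|i c IHc] s.
- by move=> /negbTE ->.
- by rewrite negb_or => /andP[hc hd]; rewrite IHd ?IHc.
- by rewrite negb_or => /andP[hc hd]; case: ifP => _; rewrite ?IHd ?IHc.
- by move=> hc; elim: (reg s 1) => [|k IH] //=; rewrite IHc.
Qed.

Lemma eval_out c s : ~~ modO c -> out (eval c s) = out s.
Proof.
elim: c s => //= [c IHc d IHd|r' t' c IHc d IHd|i c IHc] s.
- by rewrite negb_or => /andP[hc hd]; rewrite IHd ?IHc.
- by rewrite negb_or => /andP[hc hd]; case: ifP => _; rewrite ?IHd ?IHc.
- by move=> hc; elim: (reg s 1) => [|k IH] //=; rewrite IHc.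
Qed.

Lemma wf_modR c : wf c -> ~~ modR 0 c && ~~ modR 1 c.
Proof.
elim: c => //= [r r'|r|c IHc d IHd|r t c IHc d IHd|i c IHc].
- by case: r => [|[]].
- by case: r => [|[]].
- by move=> /andP[/IHc/andP[/negbTE -> /negbTE ->] /IHd].
- by move=> /and4P[_ _ /IHc/andP[/negbTE -> /negbTE ->] /IHd].
- by case: i => [|[|i]] // /and4P[_ _ /IHc/andP[/negbTE -> /negbTE ->]].
Qed.

Lemma sim_nop s : sim Nop s 0 s.
Proof.
move=> m e f Rp; exists f, e; split=> //; first by lia.
by exists 0 => //; constructor.
Qed.

Lemma sim_cmd c s : wf c -> reg s 0 = 0 -> sim (compile c) s (cost c (reg s 1)) (eval c s).
Proof.
elim: c s => /= [|r t b|r r'|r||c IHc d IHd|r t c IHc d IHd|i c IHc] s w s0.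
- exact: sim_nop.
- by case/andP: w => rr tt; apply: sim_set.
- by case/and4P: w => _ rr rr' nr; apply: sim_copy.
- by case/andP: w => _ rr; apply: sim_inc.
- exact: sim_out.
- case/andP: w => wc wd; apply: sim_seq (IHc _ wc s0) _.
  have /andP[m0 m1] := wf_modR wc.
  by rewrite -(eval_reg s m1); apply: IHd wd _; rewrite eval_reg.
- case/and4P: w => rr tt wc wd; apply: sim_if => // h.
  + by rewrite h; apply: simW (IHc _ wc s0); lia.
  + by rewrite (negbTE h); apply: simW (IHd _ wd s0); lia.
- case/and4P: w => i1 ii wc mi.
  have /andP[m0 m1] := wf_modR wc.
  have i0 : i == 0 = false by lia.
  have {}i1 : i == 1 = false by lia.
  pose S j := iter j (fun s => incR i (eval c s)) (setR i 0 s).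
  have S0 j : reg (S j) 0 = 0.
    elim: j => [|j IH] /=; rewrite eq_sym i0 //.
    by rewrite eval_reg.
  have S1 j : reg (S j) 1 = reg s 1.
    elim: j => [|j IH] /=; rewrite eq_sym i1 //.
    by rewrite eval_reg.
  have Si j : reg (S j) i = j.
    elim: j => [|j IH] /=; rewrite eqxx //.
    by rewrite eval_reg // IH.
  have cS j : cond (S j) 1 i = (reg s 1 == j) by rewrite /cond /track ii S1 Si.
  have X := sim_while (b := false) (P := compile c ;; inc_prog i)
    (D := (cost c (reg s 1)).+1) (k := reg s 1) (S := S) (r := 1) (t := i).
  have S00 : S 0 = setR i (reg s 0) s by rewrite /S /= s0.
  rewrite S00 in X.
  refine (simW _ (sim_seq (sim_copy (s := s) (r := i) (r' := 0) ii _ _) (X _ _ _ _))) => //.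
  + by lia.
  + by rewrite i0.
  + by rewrite /nreg /ntrk in ii *; lia.
  + move=> j jk; split; first by rewrite cS gtn_eqF.
    rewrite -addn1 -(S1 j); apply: sim_seq (IHc _ wc (S0 j)) _.
    exact: sim_inc.
  + by rewrite cS eqxx.
Qed.

Lemma cost_poly c : exists K d, forall n, cost c n <= K * n.+1 ^ d.
Proof.
have big a b d e n : a * n.+1 ^ d + b * n.+1 ^ e <= (a + b) * n.+1 ^ (d + e).
  by rewrite mulnDl leq_add // leq_mul // leq_pexp2l //; lia.
elim: c => /= [|r t b|r r'|r||c [K [d h]] c' [K' [d' h']]|r t c [K [d h]] c' [K' [d' h']]|i c [K [d h]]].
- by exists 0, 0.
- by exists 1, 0 => n; rewrite expn0.
- by exists 1, 0 => n; rewrite expn0.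
- by exists 1, 0 => n; rewrite expn0.
- by exists 1, 0 => n; rewrite expn0.
- exists (K + K'), (d + d') => n; apply: leq_trans (big _ _ _ _ _).
  exact: leq_add.
- exists (K + K').+1, (d + d') => n.
  have := leq_trans (leq_add (h n) (h' n)) (big _ _ _ _ _).
  have : 0 < n.+1 ^ (d + d') by rewrite expn_gt0.
  by rewrite mulSn; lia.
- exists (K + 4), d.+1 => n; rewrite expnS mulnCA; move: (h n).
  have : 0 < n.+1 ^ d by rewrite expn_gt0.
  set X := n.+1 ^ d; set Y := cost c n => X0 YX.
  have : n * Y <= n * (K * X) by rewrite leq_mul2l YX orbT.
  have : n * X >= n by rewrite leq_pmulr.
  by nia.
Qed.

Lemma condA s r t : nreg <= t -> cond s r t = arr s t (reg s r).
Proof. by rewrite /cond /track ltnNge => ->. Qed.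

Lemma condR s r t : t < nreg -> cond s r t = (reg s r == reg s t).
Proof. by rewrite /cond /track => ->. Qed.

Definition agree c s s' :=
  [/\ forall r, ~~ modR r c -> reg s' r = reg s r,
      forall t p, ~~ modA t c -> arr s' t p = arr s t p &
      ~~ modO c -> out s' = out s].

Lemma agree_eval c s : agree c s (eval c s).
Proof.
by split=> [r|t p|] h; [exact: eval_reg|exact: eval_arr|exact: eval_out].
Qed.

(** The premise [agree] hands the frame conditions of the whole loop to each round, so an invariant
    P has to mention only what changes. *)
Lemma for_rule i c s (P : nat -> store -> Prop) : ~~ modR i c ->
  P 0 (setR i 0 s) ->
  (forall k s', k < reg s 1 -> agree (Cfor i c) s s' -> reg s' i = k ->
    P k s' -> P k.+1 (incR i (eval c s'))) ->
  P (reg s 1) (eval (Cfor i c) s).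
Proof.
move=> mi P0 PS /=.
pose S j := iter j (fun s => incR i (eval c s)) (setR i 0 s).
suff H k : k <= reg s 1 -> [/\ agree (Cfor i c) s (S k), reg (S k) i = k & P k (S k)].
  by have [] := H _ (leqnn _).
elim: k => [_|k IH kn].
  split=> //=; last by rewrite eqxx.
  by split=> //= r; rewrite negb_or => /andP[/negbTE ->].
have [[a1 a2 a3] Si Pk] := IH (ltnW kn); split; last exact: PS.
  split=> /= [r|t p|] h.
  - move: (h); rewrite negb_or => /andP[/negbTE -> hr].
    by rewrite eval_reg // a1.
  - by rewrite eval_arr // a2.
  - by rewrite eval_out // a3.
by rewrite /= eqxx eval_reg // Si.
Qed.

(** * Enumeration of small subsets *)

Definition small (T : finType) s (AL : {set T}) (S : {set T}) := (S \subset AL) && (#|S| <= s).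

(* The order of the binary numbers with bits at the positions [enc e]. *)
Definition ltS (T : finType) (enc : T -> nat) (S U : {set T}) :=
  [exists e, [&& e \notin S, e \in U &
    [forall f, (enc e < enc f) ==> ((f \in S) == (f \in U))]]].

(* The carry of the binary increment starts at the lowest element of [S] when [S] is full: all
   numbers in between have more than [s] bits set. *)
Definition carried (T : finType) (enc : T -> nat) s (S : {set T}) (e : T) :=
  (#|S| != s) || [exists q in S, enc q <= enc e].

(** The place where the carry comes to rest: the first zero it meets among the allowed positions. *)
Definition carry_stop (T : finType) (enc : T -> nat) s (AL S : {set T}) (p : T) :=
  [&& p \in AL, p \notin S, carried enc s S p &
    [forall e in AL, (enc e < enc p) ==> carried enc s S e ==> (e \in S)]].

(** Everything below p can be cleared: the ones passed by the carry become zeros, and below the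
    start of the carry S has no elements. *)
Definition carry_set (T : finType) (enc : T -> nat) (S : {set T}) (p : T) :=
  [set e | (e == p) || (enc p < enc e) && (e \in S)].

Definition next_set (T : finType) (enc : T -> nat) s (AL S : {set T}) : option {set T} :=
  omap (carry_set enc S) [pick p | carry_stop enc s AL S p].

Lemma ltSP (T : finType) (enc : T -> nat) (S U : {set T}) :
  reflect (exists e, [/\ e \notin S, e \in U & forall f, enc e < enc f -> (f \in S) = (f \in U)])
    (ltS enc S U).
Proof.
apply: (iffP existsP) => -[e] => [/and3P[eS eU /forallP h]|[eS eU h]]; exists e.
  by split=> // f ef; have := h f; rewrite ef => /eqP.
by rewrite eS eU; apply/forallP => f; apply/implyP => /h ->.
Qed.

Lemma ltS_irr (T : finType) (enc : T -> nat) (S : {set T}) : ltS enc S S = false.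
Proof. by apply/ltSP => -[e [/negP]]. Qed.

Lemma ltS_trans (T : finType) (enc : T -> nat) : injective enc -> transitive (ltS enc).
Proof.
move=> encI U S V /ltSP[e [eS eU he]] /ltSP[f [fU fV hf]]; apply/ltSP.
case: (ltngtP (enc e) (enc f)) => ef.
- exists f; split=> //; first by rewrite he.
  by move=> g fg; rewrite he ?hf //; apply: ltn_trans fg.
- exists e; split=> //; first by rewrite -hf.
  by move=> g eg; rewrite he ?hf //; apply: ltn_trans eg.
- by move: eU; rewrite (encI _ _ ef) (negbTE fU).
Qed.

Lemma ltS_total0 (T : finType) (enc : T -> nat) (S : {set T}) : S != set0 -> ltS enc set0 S.
Proof.
case/set0Pn => e0 e0S; case: (arg_maxnP enc e0S) => e eS emax.
apply/ltSP; exists e; split=> // [|f ef]; first by rewrite inE.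
by rewrite inE; apply/esym/negbTE/negP => /emax; rewrite /geq /= leqNgt ef.
Qed.

(** At the highest difference e of S and U the carry is already under way: if S were full with all
    its elements above e, then U would contain S and e, which is more than s elements. *)
Lemma gap (T : finType) (enc : T -> nat) s (AL S U : {set T}) : injective enc ->
  small s AL S -> small s AL U -> ltS enc S U ->
  exists e, [/\ e \in AL, e \notin S, e \in U, carried enc s S e
    & forall f, enc e < enc f -> (f \in S) = (f \in U)].
Proof.
move=> encI /andP[SA Ss] /andP[UA Us] /ltSP[e [eS eU he]]; exists e; split=> //.
  exact: (subsetP UA).
rewrite /carried; case: (#|S| =P s) => //= Sfull.
apply: contraT => /existsPn h.
have sub : e |: S \subset U.
  apply/subsetP => f; rewrite in_setU1 => /predU1P[-> //|fS].
  by rewrite -he //; have := h f; rewrite fS /= -ltnNge.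
by have := subset_leq_card sub; rewrite cardsU1 eS Sfull; lia.
Qed.

(** The position supplied by [gap] is allowed, carried and outside S; the least position of this
    kind would be a stopping place. *)
Lemma next_none (T : finType) (enc : T -> nat) s (AL S U : {set T}) : injective enc ->
  small s AL S -> small s AL U -> next_set enc s AL S = None -> ~~ ltS enc S U.
Proof.
move=> encI sS sU; rewrite /next_set; case: pickP => // noP _.
apply/negP => /(gap encI sS sU)[e0 [e0A e0S _ e0c _]].
pose Q e := [&& e \in AL, e \notin S & carried enc s S e].
have Q0 : Q e0 by apply/and3P.
case: (arg_minnP enc Q0) => e /and3P[eA eS ec] emin.
have /negP := negbT (noP e); apply; rewrite /carry_stop eA eS ec /=.
apply/forallP => f; apply/implyP => fA; apply/implyP => fe; apply/implyP => fc.
apply/negPn/negP => fS; have := emin f; rewrite /Q fA fS fc => /(_ isT).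
by rewrite leqNgt fe.
Qed.

Lemma next_some (T : finType) (enc : T -> nat) s (AL S S' : {set T}) : injective enc ->
  small s AL S -> next_set enc s AL S = Some S' ->
  [/\ small s AL S', ltS enc S S' &
    forall U, small s AL U -> ltS enc S U -> (S' == U) || ltS enc S' U].
Proof.
move=> encI sS; rewrite /next_set; case: pickP => // p pP [<-] {S'}.
have /and4P[pA pS pc /forallP pmin] := pP.
have {}pmin f : f \in AL -> enc f < enc p -> carried enc s S f -> f \in S.
  by move=> fA fp fc; have := pmin f; rewrite fA fp fc.
have S'E f : (f \in carry_set enc S p) = (f == p) || (enc p < enc f) && (f \in S).
  by rewrite inE.
split.
- case/andP: sS => SA Ss; apply/andP; split.
    by apply/subsetP => f; rewrite S'E => /predU1P[-> //|/andP[_ /(subsetP SA)]].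
  have sub1 : carry_set enc S p \subset p |: S.
    by apply/subsetP => f; rewrite S'E in_setU1 => /predU1P[->|/andP[_ ->]]; rewrite ?eqxx ?orbT.
  case/orP: pc => [nfull|/existsP[q /andP[qS qp]]].
    by have := subset_leq_card sub1; rewrite cardsU1 pS; lia.
  (* A full S loses the element q below p, which pays for the new element p. *)
  have sub : carry_set enc S p \subset p |: (S :\ q).
    apply/subsetP => f; rewrite S'E !inE => /predU1P[->|/andP[pf ->]]; rewrite ?eqxx //.
    by rewrite andbT orbC; case: eqVneq => // fq; move: pf; rewrite fq ltnNge qp.
  have := subset_leq_card sub; rewrite cardsU1.
  by have := cardsD1 q S; rewrite qS; case: (p \notin _) => /=; lia.
- apply/ltSP; exists p; split=> //; first by rewrite S'E eqxx.
  by move=> f pf; rewrite S'E pf; case: eqVneq pf => // ->; rewrite ltnn.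
- move=> U sU /(gap encI sS sU)[e [eA eS eU ec he]].
  (* Let e be the highest difference of S and U. Below p it would have stopped the carry earlier;
     above p it makes U larger than the successor; at p the successor agrees with U from p upwards
     and is empty below. *)
  case: (ltngtP (enc e) (enc p)) => ep.
  + by rewrite (pmin e) in eS.
  + apply/orP; right; apply/ltSP; exists e; split=> //.
      rewrite S'E (negbTE eS) andbF orbF; apply/eqP => E.
      by rewrite E ltnn in ep.
    move=> f ef; have pf := ltn_trans ep ef.
    by rewrite S'E pf he //; case: eqVneq pf => // ->; rewrite ltnn.
  + have {ep}E := encI _ _ ep; subst e.
    case: eqVneq => //= ne.
    have hp f : enc p <= enc f -> (f \in carry_set enc S p) = (f \in U).
      rewrite S'E leq_eqVlt => /orP[/eqP /encI <-|pf]; first by rewrite eqxx eU.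
      by rewrite pf he //; case: eqVneq pf => // ->; rewrite ltnn.
    pose D := U :\: carry_set enc S p.
    have [f0 f0D] : exists f, f \in D.
      apply/set0Pn; apply: contra ne; rewrite setD_eq0 => /subsetP UC.
      rewrite eqEsubset; apply/andP; split; apply/subsetP => f; last exact: UC.
      by rewrite S'E => /predU1P[-> //|/andP[pf]]; rewrite he.
    case: (arg_maxnP enc f0D) => f /setDP[fU fC] fmax.
    apply/ltSP; exists f; split=> // g fg.
    case: (leqP (enc p) (enc g)) => pg; first exact: hp.
    have -> : (g \in carry_set enc S p) = false.
      by rewrite S'E [enc p < _]ltnNge (ltnW pg); case: eqVneq pg => // ->; rewrite ltnn.
    apply/esym/negbTE/negP => gU.
    have gD : g \in D.
      rewrite !inE gU andbT negb_or [enc p < _]ltnNge (ltnW pg) /= andbT.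
      by case: eqVneq pg => // ->; rewrite ltnn.
    by have := fmax g gD; rewrite /geq /= leqNgt fg.
Qed.

(** * The search over growing budgets *)

Definition search_step (T : finType) (enc : T -> nat) (AL : nat -> {set T}) (c : nat * {set T}) :=
  if next_set enc c.1 (AL c.1) c.2 is Some S' then (c.1, S') else (c.1.+1, set0).

(** Induction on the number of small sets above S, which drops with every successor. The invariant
    that no good set lies below S turns the lack of a successor into a proof that this budget has no
    good set. *)
Lemma search_phase (T : finType) (enc : T -> nat) (AL : nat -> {set T}) (good : pred {set T}) s S :
  injective enc -> small s (AL s) S ->
  (forall U, small s (AL s) U -> good U -> (S == U) || ltS enc S U) ->
  exists t, [/\ t <= #|[set U | small s (AL s) U && ltS enc S U]|.+1,
    forall j, j < t -> ~~ good (iter j (search_step enc AL) (s, S)).2 &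
    let c := iter t (search_step enc AL) (s, S) in
      [/\ c.1 = s, small s (AL s) c.2 & good c.2] \/
      c = (s.+1, set0) /\ forall U, small s (AL s) U -> ~~ good U].
Proof.
move=> encI; move: {2}#|_| (leqnn #|[set U | small s (AL s) U && ltS enc S U]|) => k.
elim: k S => [|k IH] S kS sS gS; case gd: (good S); try by exists 0; split=> //; left.
all: case E: (next_set enc s (AL s) S) => [S'|]; last first.
1,3: exists 1; split=> //=; first (by case=> // _; rewrite gd);
  right; rewrite /search_step /= E; split=> // U sU; apply/negP => gU;
  have := gS U sU gU; rewrite (negbTE (next_none encI sS sU E)) orbF;
  by move=> /eqP SU; rewrite -SU gd in gU.
all: have [sS' SS' S'min] := next_some encI sS E.
  have /card0_eq/(_ S') : #|[set U | small s (AL s) U && ltS enc S U]| = 0 by lia.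
  by rewrite inE sS' SS'.
have lt : #|[set U | small s (AL s) U && ltS enc S' U]| <
          #|[set U | small s (AL s) U && ltS enc S U]|.
  apply/proper_card/properP; split.
    apply/subsetP => U; rewrite !inE => /andP[-> ]; exact: ltS_trans.
  by exists S'; rewrite !inE sS' ?SS' // ltS_irr.
have [||t [tt gt ct]] := IH S' _ sS'; first by lia.
  move=> U sU gU; have := gS U sU gU; case: eqVneq => [SU|_ /=]; last exact: S'min.
  by rewrite -SU gd in gU.
have stepE : search_step enc AL (s, S) = (s, S') by rewrite /search_step /= E.
exists t.+1; split; first by lia.
- by case=> [|j] jt; rewrite ?gd // iterSr stepE gt.
- by rewrite /= -iterS iterSr stepE.
Qed.

Lemma search_correct (T : finType) (enc : T -> nat) (AL : nat -> {set T}) (good : pred {set T}) s0 K :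
  injective enc ->
  (forall s, s <= s0 -> #|[set U | small s (AL s) U]| <= K) ->
  (forall s U, s < s0 -> small s (AL s) U -> ~~ good U) ->
  (exists2 U, small s0 (AL s0) U & good U) ->
  exists t S, [/\ t <= s0.+1 * K.+1, iter t (search_step enc AL) (0, set0) = (s0, S), good S &
    forall j, j < t -> ~~ good (iter j (search_step enc AL) (0, set0)).2].
Proof.
move=> encI hK no [U0 sU0 gU0].
have sm0 s : small s (AL s) set0 by rewrite /small sub0set cards0.
have start s U : small s (AL s) U -> good U -> (set0 == U) || ltS enc set0 U.
  by move=> _ _; rewrite eq_sym -implyNb; apply/implyP; apply: ltS_total0.
(* Phases are joined backwards from the last one: k budgets below s0 are still to be exhausted. *)
suff H k : k <= s0 -> exists t S, [/\ t <= k.+1 * K.+1,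
    iter t (search_step enc AL) (s0 - k, set0) = (s0, S), good S &
    forall j, j < t -> ~~ good (iter j (search_step enc AL) (s0 - k, set0)).2].
  by have := H s0 (leqnn _); rewrite subnn.
have phase s : s <= s0 -> exists t, [/\ t <= K.+1,
    forall j, j < t -> ~~ good (iter j (search_step enc AL) (s, set0)).2 &
    let c := iter t (search_step enc AL) (s, set0) in
      [/\ c.1 = s, small s (AL s) c.2 & good c.2] \/
      c = (s.+1, set0) /\ forall U, small s (AL s) U -> ~~ good U].
  move=> ss0; have [t [tt gt ct]] := search_phase encI (sm0 s) (start s).
  exists t; split=> //; apply: leq_trans tt _; rewrite ltnS; apply: leq_trans (hK _ ss0).
  by apply/subset_leq_card/subsetP => V; rewrite !inE => /andP[].
elim: k => [|k IH] ks0.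
  rewrite subn0; have [t [tt gt]] := phase s0 (leqnn _).
  case=> [[c1 c2 gc]|[_ /(_ U0 sU0)]]; last by rewrite gU0.
  exists t, (iter t (search_step enc AL) (s0, set0)).2; split=> //; first by rewrite mul1n.
  by rewrite -{2}c1 -surjective_pairing.
have [t [tt gt]] := phase (s0 - k.+1) (leq_subr _ _); set s := s0 - k.+1 in gt *.
case=> [[c1 c2 gc]|[ct _]].
  have ss : s < s0 by rewrite /s; lia.
  by have := no _ _ ss c2; rewrite gc.
have [|u [S [uu uE gS gu]]] := IH; first exact: ltnW.
have sE : s.+1 = s0 - k by rewrite /s; lia.
exists (u + t), S; split=> //.
- by rewrite mulSn; lia.
- by rewrite iterD ct sE.
- move=> j ju; case: (ltnP j t) => jt; first exact: gt.
  by rewrite -(subnK jt) iterD ct sE gu //; lia.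
Qed.

(** A set with at most s elements is described by s slots, each empty or filled with an element of
    AL. *)
Lemma card_small (T : finType) s (AL : {set T}) :
  #|[set U : {set T} | small s AL U]| <= #|AL|.+1 ^ s.
Proof.
pose im (f : {ffun 'I_s -> option {x | x \in AL}}) : {set T} :=
  [set x | [exists i, omap val (f i) == Some x]].
have sub : [set U | small s AL U] \subset [set im f | f in setT].
  apply/subsetP => U; rewrite inE => /andP[/subsetP UA Us].
  pose f : {ffun 'I_s -> option {x | x \in AL}} :=
    [ffun i : 'I_s => if nth None [seq Some x | x <- enum U] i is Some x then insub x else None].
  apply/imsetP; exists f; rewrite ?inE //; apply/setP => x; rewrite inE.
  apply/idP/existsP => [xU|[i]].
    have xi : index x (enum U) < #|U| by rewrite cardE index_mem mem_enum.
    exists (Ordinal (leq_trans xi Us)); rewrite ffunE /=.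
    rewrite (nth_map x) -?cardE // nth_index ?mem_enum //.
    by rewrite (insubT (mem AL) (UA x xU)).
  rewrite ffunE; case: (ltnP i (size (enum U))) => iU.
    rewrite (nth_map x) //; set y := nth _ _ _.
    have yU : y \in U by rewrite -mem_enum mem_nth.
    by rewrite (insubT (mem AL) (UA y yU)) /= => /eqP[<-].
  by rewrite nth_default ?size_map.
apply: leq_trans (subset_leq_card sub) _; apply: leq_trans (leq_imset_card _ _) _.
by rewrite cardsT card_ffun card_option card_sig card_ord (eq_card (B := mem AL)).
Qed.

(** * Twins, vertex covers and the size of irregulators *)

Lemma bigmin_le (I : finType) (P : pred I) (F : I -> nat) m i :
  P i -> \big[minn/m]_(j | P j) F j <= F i.
Proof.
move=> Pi; have := mem_index_enum i; elim: (index_enum I) => //= j r IH.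
rewrite inE big_cons => /predU1P[<-|/IH h]; first by rewrite Pi geq_minl.
by case: ifP => // _; apply: leq_trans (geq_minr _ _) h.
Qed.

Lemma bigmin_attained (I : finType) (P : pred I) (F : I -> nat) i :
  P i -> exists2 j, P j & \big[minn/F i]_(j | P j) F j = F j.
Proof.
move=> Pi; apply: (big_ind (fun v => exists2 j, P j & v = F j)); first by exists i.
- move=> _ _ [a Pa ->] [b Pb ->]; rewrite /minn; case: ifP => _; by [exists a|exists b].
- by move=> j Pj; exists j.
Qed.

Lemma adj_del_sym n (G : sgraph n) S : symmetric (adj_del G S).
Proof. by move=> x y; rewrite /adj_del adj_sym -!andbA; congr andb; rewrite andbC. Qed.

Lemma deg_del_eq n (G : sgraph n) S U : adj_del G S =2 adj_del G U ->
  deg_del G S =1 deg_del G U.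
Proof. by move=> h x; apply: eq_card => y; rewrite !inE h. Qed.

Lemma locally_irregularP n (G : sgraph n) S :
  reflect (forall x y, adj_del G S x y -> deg_del G S x != deg_del G S y)
    (locally_irregular_del G S).
Proof.
apply: (iffP forallP) => h x; first by move=> y; have /forallP/(_ y)/implyP := h x.
by apply/forallP => y; apply/implyP; apply: h.
Qed.

Lemma vc_attained n (G : sgraph n) : exists2 C, vertex_cover G C & #|C| = vc G.
Proof.
have cT : vertex_cover G setT.
  by apply/forallP => x; apply/forallP => y; rewrite !inE implybT.
have [C cC E] := bigmin_attained (fun C : {set 'I_n} => #|C|) cT.
by exists C => //; rewrite /vc -E cardsT card_ord.
Qed.

Lemma Ie_attained n (G : sgraph n) : exists2 S, edge_irregulator G S & #|S| = Ie G.
Proof.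
have eE : edge_irregulator G (edges G).
  rewrite /edge_irregulator subxx; apply/locally_irregularP => x y.
  rewrite /adj_del !inE /= (adj_sym _ y); case: (boolP (adj G x y)) => //= xy.
  rewrite !andbT -!leqNgt => h; have xE : x = y by apply/val_inj/eqP; rewrite eqn_leq andbC.
  by rewrite xE adj_irr in xy.
by have [S eS E] := bigmin_attained (fun S : {set 'I_n * 'I_n} => #|S|) eE; exists S; rewrite // /Ie -E.
Qed.

(** S may contain both orientations of an edge, and non-edges. Orienting its pairs upwards and
    keeping only edges deletes the same edges of G and does not increase the cardinality. *)
Lemma Ie_le n (G : sgraph n) S : locally_irregular_del G S -> Ie G <= #|S|.
Proof.
move=> irr; pose orient (p : 'I_n * 'I_n) := if p.1 < p.2 then p else (p.2, p.1).
pose U := edges G :&: orient @: S.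
have US : adj_del G U =2 adj_del G S.
  have h x y : adj G x y -> x < y -> ((x, y) \in U) = ((x, y) \in S) || ((y, x) \in S).
    move=> xy ltxy; rewrite !inE /= ltxy xy /=; apply/imsetP/orP.
      case=> [[a b]] abS; rewrite /orient /=; case: ifP => _ [-> ->]; by [left|right].
    case=> h; [exists (x, y) | exists (y, x)] => //; rewrite /orient /= ?ltxy //.
    by rewrite ltnNge (ltnW ltxy).
  have h' (x y : 'I_n) : x <= y -> (y, x) \in U = false.
    by move=> xy; rewrite !inE /= ltnNge xy.
  suff H (x y : 'I_n) : x < y -> adj_del G U x y = adj_del G S x y.
    move=> x y; case: (ltngtP x y) => xy; first exact: H.
      by rewrite adj_del_sym H // adj_del_sym.
    by rewrite /adj_del (val_inj xy) adj_irr.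
  move=> xy; rewrite /adj_del; case: (boolP (adj G x y)) => //= axy.
  by rewrite h // (h' _ _ (ltnW xy)) andbT negb_or.
have eU : edge_irregulator G U.
  rewrite /edge_irregulator subsetIl; apply/locally_irregularP => x y.
  by rewrite US !(deg_del_eq US); apply/locally_irregularP.
apply: leq_trans (bigmin_le _ _ eU) _.
by apply: leq_trans (subset_leq_card (subsetIr _ _)) (leq_imset_card _ _).
Qed.

(* Delete all edges inside a vertex cover [C] and all edges at the vertices of [C] with at most
   [#|C|] neighbours outside: the others keep more than [#|C|] neighbours, and vertices outside
   [C] have degree at most [#|C|]. *)
Lemma Ie_le_vc n (G : sgraph n) : Ie G <= 2 * vc G ^ 2.
Proof.
have [C /forallP cC <-] := vc_attained G.
have {}cC x y : adj G x y -> x \notin C -> y \in C.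
  by have /forallP/(_ y)/implyP h := cC x; move=> /h /orP[-> //|].
pose N u := [set y | adj G u y & y \notin C].
pose D := [set u in C | #|N u| <= #|C|].
pose S := setX C C :|: [set p | (p.1 \in D) && (p.2 \in N p.1)].
have cS : #|S| <= 2 * #|C| ^ 2.
  rewrite mul2n -addnn; apply: leq_trans (leq_card_setU _ _) _.
  rewrite cardsX expnS expn1 leq_add2l.
  rewrite -sum1_card (eq_bigl (fun p => (p.1 \in D) && (p.2 \in N p.1))); last first.
    by move=> p; rewrite inE.
  rewrite -(pair_big_dep (mem D) (fun u y => y \in N u) (fun _ _ => 1)) /=.
  apply: (@leq_trans (\sum_(u in D) #|C|)).
    by apply: leq_sum => u; rewrite inE => /andP[_]; rewrite -sum1_card.
  rewrite sum_nat_const leq_mul2r; apply/orP; right.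
  by apply/subset_leq_card/subsetP => u; rewrite inE => /andP[].
apply: leq_trans cS; apply: Ie_le.
have E x y : x \in C -> adj_del G S x y -> [/\ adj G x y, y \notin C & x \notin D].
  move=> xC; rewrite /adj_del !inE xC /= => /andP[/andP[xy h1 _]]; move: h1.
  rewrite xy negb_or; case: (y \in C) => //=; rewrite andbT; split=> //.
have dC x : x \in C -> x \notin D -> #|C| < deg_del G S x.
  move=> xC xD; move: (xD); rewrite inE xC /= -ltnNge => h; apply: leq_trans h _.
  apply/subset_leq_card/subsetP => y; rewrite !inE => /andP[xy yC].
  rewrite /adj_del xy !inE /= xC (negbTE yC) /= ?andbF /=.
  by move: xD; rewrite inE xC /= => /negbTE ->.
have dN x : x \notin C -> deg_del G S x <= #|C|.
  move=> xC; apply/subset_leq_card/subsetP => y; rewrite inE /adj_del => /andP[/andP[xy _ _]].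
  exact: cC xC.
apply/locally_irregularP => x y xy.
case: (boolP (x \in C)) => xC.
  have [_ yC xD] := E _ _ xC xy.
  by have := dC _ xC xD; have := dN _ yC; case: eqP => //; lia.
have yC : y \in C by apply: cC xC; move: xy; rewrite /adj_del => /andP[/andP[]].
rewrite adj_del_sym in xy; have [_ _ yD] := E _ _ yC xy.
by have := dC _ yC yD; have := dN _ xC; case: eqP => //; lia.
Qed.

(** * Twins and the number of candidates *)

Definition twin n (G : sgraph n) (u v : 'I_n) := [forall z, adj G u z == adj G v z].

Definition twin_rank n (G : sgraph n) (v : 'I_n) := #|[set u : 'I_n | (u < v) && twin G u v]|.

Definition allowed n (G : sgraph n) s := [set v : 'I_n | twin_rank G v < s.*2].

Definition allowed_pairs n (G : sgraph n) s :=
  [set p : 'I_n * 'I_n | [&& adj G p.1 p.2, p.1 \in allowed G s & p.2 \in allowed G s]].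

Definition touched n (S : {set 'I_n * 'I_n}) := [set p.1 | p in S] :|: [set p.2 | p in S].

Lemma twinP n (G : sgraph n) u v : reflect (forall z, adj G u z = adj G v z) (twin G u v).
Proof. by apply: (iffP forallP) => h z; apply/eqP; apply: h. Qed.

Lemma adj_tperm n (G : sgraph n) u v x y : twin G u v ->
  adj G (tperm u v x) (tperm u v y) = adj G x y.
Proof.
move=> /twinP tw; have h a z : adj G (tperm u v a) z = adj G a z.
  by case: tpermP => // ->; rewrite tw.
by rewrite h adj_sym h adj_sym.
Qed.

Definition swap_set n (u v : 'I_n) (S : {set 'I_n * 'I_n}) :=
  [set (tperm u v p.1, tperm u v p.2) | p in S].

Lemma locally_irregular_swap n (G : sgraph n) u v S : twin G u v ->
  locally_irregular_del G S -> locally_irregular_del G (swap_set u v S).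
Proof.
move=> tw /locally_irregularP irr.
have memS x y : ((tperm u v x, tperm u v y) \in swap_set u v S) = ((x, y) \in S).
  rewrite -[(_, _)]/((fun p => (tperm u v p.1, tperm u v p.2)) (x, y)) mem_imset //.
  by move=> [a b] [a' b'] [/perm_inj -> /perm_inj ->].
have adjS x y : adj_del G (swap_set u v S) (tperm u v x) (tperm u v y) = adj_del G S x y.
  by rewrite /adj_del adj_tperm // !memS.
have degS x : deg_del G (swap_set u v S) (tperm u v x) = deg_del G S x.
  rewrite /deg_del -(card_imset [set y | adj_del G S x y] (@perm_inj _ (tperm u v))).
  apply: eq_card => y; rewrite inE -{1}(tpermK u v y) adjS.
  by rewrite -{2}(tpermK u v y) mem_imset ?inE //; apply: perm_inj.
apply/locally_irregularP => x y; rewrite -(tpermK u v x) -(tpermK u v y) adjS !degS.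
exact: irr.
Qed.

Lemma touched_swap n (u v : 'I_n) S : touched (swap_set u v S) = tperm u v @: touched S.
Proof. by rewrite /touched imsetU -!imset_comp. Qed.

Lemma card_touched n (S : {set 'I_n * 'I_n}) : #|touched S| <= #|S|.*2.
Proof.
by rewrite -addnn; apply: leq_trans (leq_card_setU _ _) _; rewrite leq_add ?leq_imset_card.
Qed.

(** The s pairs have at most 2s ends. If one of them, v, has at least 2s smaller twins, then some
    smaller twin u is no end. Swapping u and v keeps irregularity and lowers the sum of the ends, so
    the process terminates. *)
Lemma exchange n (G : sgraph n) s S : locally_irregular_del G S ->
  (forall p, p \in S -> adj G p.1 p.2) -> #|S| <= s ->
  exists2 U, small s (allowed_pairs G s) U & locally_irregular_del G U.
Proof.
move: {2}(\sum_(x in touched S) x) (leqnn (\sum_(x in touched S) x)) => w.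
elim/ltn_ind: w S => w IH S Sw irr adjS Ss.
case: (boolP (touched S \subset allowed G s)) => [/subsetP tA|].
  exists S => //; rewrite /small Ss andbT; apply/subsetP => p pS; rewrite inE adjS //=.
  by rewrite !tA // !inE imset_f ?orbT.
case/subsetPn => v vS; rewrite inE -leqNgt => vr.
have : ~~ ([set u : 'I_n | (u < v) && twin G u v] \subset touched S :\ v).
  apply/negP => /subset_leq_card; rewrite -/(twin_rank G v).
  by have := card_touched S; rewrite (cardsD1 v) vS; lia.
case/subsetPn => u; rewrite !inE => /andP[uv tw].
rewrite negb_and negbK -(inj_eq val_inj) (ltn_eqF uv) /= => uS.
have {}uS : u \notin touched S by rewrite !inE.
have lt : \sum_(x in touched (swap_set u v S)) x < \sum_(x in touched S) x.
  rewrite touched_swap big_imset /=; last by move=> x y _ _; apply: perm_inj.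
  rewrite (bigD1 v) //= [X in _ < X](bigD1 v) //= tpermR -addSn leq_add //.
  apply: leq_sum => x /andP[xS xv]; rewrite tpermD //; last by rewrite eq_sym.
  by apply: contraNneq uS => ->.
apply: (IH _ (leq_trans lt Sw) (swap_set u v S)) => //.
- exact: locally_irregular_swap.
- by move=> _ /imsetP[p pS ->] /=; rewrite adj_tperm // adjS.
- exact: leq_trans (leq_imset_card _ _) Ss.
Qed.

Lemma Ie_small n (G : sgraph n) :
  exists2 U, small (Ie G) (allowed_pairs G (Ie G)) U & locally_irregular_del G U.
Proof.
have [S /andP[/subsetP Se irr] Sc] := Ie_attained G.
apply: (exchange irr); last by rewrite Sc.
by move=> p /Se; rewrite inE => /andP[].
Qed.

Lemma small_lt_Ie n (G : sgraph n) s A U : s < Ie G -> small s A U ->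
  ~~ locally_irregular_del G U.
Proof.
move=> sI /andP[_ Us]; apply/negP => /Ie_le; lia.
Qed.

(** An allowed vertex outside the cover C is determined by its neighbourhood, a subset of C, and its
    rank, a number below 2s: ranks increase strictly among twins. *)
Lemma card_allowed n (G : sgraph n) s : #|allowed G s| <= vc G + 2 ^ vc G * s.*2.
Proof.
have [C /forallP cC <-] := vc_attained G.
have {}cC x y : adj G x y -> x \notin C -> y \in C.
  by have /forallP/(_ y)/implyP h := cC x; move=> /h /orP[-> //|].
case sE: (s.*2) => [|k].
  by rewrite (_ : allowed G s = set0) ?cards0 //; apply/setP => v; rewrite !inE sE.
rewrite -(cardsID C (allowed G s)) leq_add ?subset_leq_card ?subsetIr //.
pose f v := ([set y | adj G v y], inord (twin_rank G v) : 'I_k.+1).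
have finj : {in allowed G s :\: C &, injective f}.
  have rlt (u v : 'I_n) : u < v -> twin G u v -> twin_rank G u < twin_rank G v.
    move=> uv tw; apply/proper_card/properP; split.
      apply/subsetP => x; rewrite !inE => /andP[xu /twinP xtw]; rewrite (ltn_trans xu uv).
      by apply/twinP => z; rewrite xtw; apply/twinP.
    by exists u; rewrite !inE ?uv ?ltnn.
  move=> u v; rewrite !inE sE => /andP[_ ur] /andP[_ vr] [/setP N].
  move=> /(congr1 val); rewrite /= !inordK // => r.
  have tw : twin G u v by apply/twinP => z; have := N z; rewrite !inE.
  have tw' : twin G v u by apply/twinP => z; have := N z; rewrite !inE.
  case: (ltngtP u v) => uv; last exact: val_inj.
    by have := rlt _ _ uv tw; rewrite r ltnn.
  by have := rlt _ _ uv tw'; rewrite r ltnn.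
rewrite -(card_in_imset finj) -card_powerset -[X in _ * X]card_ord -cardsT -cardsX.
apply/subset_leq_card/subsetP => _ /imsetP[v + ->]; rewrite !inE andbT => /andP[vC _].
by apply/subsetP => y; rewrite inE => /cC/(_ vC).
Qed.

Lemma card_allowed_pairs n (G : sgraph n) s : #|allowed_pairs G s| <= #|allowed G s| ^ 2.
Proof.
rewrite expnS expn1 -cardsX; apply/subset_leq_card/subsetP => p.
by rewrite !inE => /and3P[_ -> ->].
Qed.

(** For k > 0 and s <= 2 k^2 there are at most k + 2^k * 4 k^2 <= 5 * 2^{3k} <= 2^{6k} allowed
    vertices, so the number of allowed pairs plus one is at most 2^{13k}. Its s-th power is at most
    2^{26 k^3}. *)
Lemma card_candidates n (G : sgraph n) s : s <= Ie G ->
  #|[set U | small s (allowed_pairs G s) U]| <= 2 ^ (26 * vc G ^ 4).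
Proof.
move=> sI; apply: leq_trans (card_small _ _) _.
have {sI} := leq_trans sI (Ie_le_vc G); have := card_allowed G s.
have := card_allowed_pairs G s; set A := #|_|; set a := #|_|; set k := vc G => Aa ak sk.
(* For k = 0 the bound on s leaves only the empty set. *)
have [k0|k0] := posnP k; first by move: sk; rewrite k0 leqn0 => /eqP ->.
have kX : k < 2 ^ k by rewrite ltn_expl.
have X1 : 0 < 2 ^ k by rewrite expn_gt0.
have a6 : a <= 2 ^ (6 * k).
  have -> : 6 * k = 3 * k + 3 * k by lia.
  rewrite expnD; apply: (@leq_trans (2 ^ (3 * k) * 2 ^ 3)); last first.
    by rewrite leq_mul2l leq_exp2l // leq_pmulr ?orbT.
  rewrite [3 * k]mulnC expnM; move: kX X1 ak sk; move: (2 ^ k) => X.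
  move=> kX X1 ak sk; have X3 : X ^ 3 = X * (X * X) by rewrite !expnS expn0 muln1.
  have kk : k ^ 2 <= X * X by rewrite expnS expn1 leq_mul // ltnW.
  have XX : X * s.*2 <= X * (4 * (X * X)) by rewrite leq_mul2l; apply/orP; right; lia.
  have X13 : X <= X ^ 3 by rewrite X3 leq_pmulr // muln_gt0 X1.
  rewrite X3 in X13 *; lia.
have A13 : A.+1 <= 2 ^ (13 * k).
  have : a ^ 2 <= 2 ^ (12 * k).
    by rewrite (_ : 12 * k = 6 * k * 2); [rewrite expnM leq_exp2r|lia].
  have : 2 ^ (13 * k) = 2 ^ (12 * k) * 2 ^ k by rewrite -expnD; congr (2 ^ _); lia.
  have : 0 < 2 ^ (12 * k) by rewrite expn_gt0.
  by nia.
apply: (@leq_trans ((2 ^ (13 * k)) ^ s)); first by case: (posnP s) => [-> //|s0]; rewrite leq_exp2r.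
rewrite -expnM leq_exp2l //; apply: (@leq_trans (13 * k * (2 * k ^ 2))).
  by rewrite leq_mul2l sk orbT.
have -> : 13 * k * (2 * k ^ 2) = 26 * k ^ 3 by rewrite !expnS expn0; nia.
by rewrite leq_mul2l leq_pexp2l.
Qed.

(** * The algorithm as a loop program *)

(* Register 2 is the block of the entry (0, 0) of the matrices stored in the tracks [tIN] (input),
   [tH] (the graph without the current set), [tA] (allowed pairs) and [tS] (current set);
   registers 3 and 4 hold s and 2s, 5 to 7 are scratch of [index_cmd], 8 to 10 are loop counters,
   11 and 12 matrix indices, 13 to 15 cardinals. A flag is a track read at block 0. *)
Notation rS := 3 (only parsing).
Notation r2S := 4 (only parsing).
Notation tIN := 30 (only parsing).
Notation tH := 31 (only parsing).
Notation tV := 32 (only parsing).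
Notation tA := 33 (only parsing).
Notation tS := 34 (only parsing).
Notation fOK := 35 (only parsing).
Notation fTW := 36 (only parsing).
Notation fLT := 37 (only parsing).
Notation fST := 38 (only parsing).
Notation fCA := 39 (only parsing).

(** The only arithmetic is the increment, so no product is formed: register 5 runs through the
    positions of a matrix in row order and is copied when the two counters agree with x and y. *)
Definition index_cmd x y r :=
  Ccopy 5 2 ;+
  Cfor 6 (Cfor 7 (Cif 6 x (Cif 7 y (Ccopy r 5) Cnop) Cnop ;+ Cinc 5)).

Arguments eval : simpl never.

Lemma eval_nop s : eval Cnop s = s. Proof. by []. Qed.
Lemma eval_set r t b s : eval (Cset r t b) s = setA t (reg s r) b s. Proof. by []. Qed.
Lemma eval_copy r r' s : eval (Ccopy r r') s = setR r (reg s r') s. Proof. by []. Qed.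
Lemma eval_inc r s : eval (Cinc r) s = incR r s. Proof. by []. Qed.
Lemma eval_incO s : eval Cout s = incO s. Proof. by []. Qed.
Lemma eval_seq c d s : eval (c ;+ d) s = eval d (eval c s). Proof. by []. Qed.
Lemma eval_if r t c d s :
  eval (Cif r t c d) s = if cond s r t then eval c s else eval d s. Proof. by []. Qed.

Definition evalE := (eval_seq, eval_if, eval_nop, eval_set, eval_copy, eval_inc, eval_incO).

Lemma eval_index x y r s : x < nreg -> y < nreg ->
  all (fun z => z \notin [:: 5; 6; 7; r]) [:: x; y] -> r \notin [:: 1; 2; 5; 6; 7] ->
  reg s x < reg s 1 -> reg s y < reg s 1 ->
  reg (eval (index_cmd x y r) s) r = reg s 2 + (reg s x * reg s 1 + reg s y).
Proof.
move=> xr yr; rewrite /= !inE !negb_or.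
case/andP=> /and4P[/negbTE x5 /negbTE x6 /negbTE x7 /negbTE xnr].
rewrite andbT => /and4P[/negbTE y5 /negbTE y6 /negbTE y7 /negbTE ynr].
case/and5P=> /negbTE r1 /negbTE r2 /negbTE r5 /negbTE r6 /negbTE r7.
set n := reg s 1; set b := reg s 2; set X := reg s x; set Y := reg s y => Xn Yn.
rewrite /index_cmd eval_seq eval_copy.
set s0 := setR 5 (reg s 2) s; set c5 := Cif 6 x _ _ ;+ _; set c7 := Cfor 7 c5.
have N0 : reg s0 1 = n by [].
have H := @for_rule 6 c7 s0 (fun k s' => reg s' 5 = b + k * n /\ (X < k -> reg s' r = b + (X * n + Y))).
have [] := H; last by rewrite N0 => _ /(_ Xn).
- by rewrite /c7 /c5 /= !orbF eq_sym r6.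
- by rewrite mul0n addn0.
move=> {H} k s1; rewrite N0 => kn [a1 _ _] s16 [s15 s1r].
have s1n : reg s1 1 = n by rewrite a1 // /c7 /c5 /= [1 == r]eq_sym r1.
have s1x : reg s1 x = X by rewrite a1 /c7 /c5 /= ?x5 ?x6 ?x7 ?xnr //= /s0 /= x5.
have s1y : reg s1 y = Y by rewrite a1 /c7 /c5 /= ?y5 ?y6 ?y7 ?ynr //= /s0 /= y5.
have H := @for_rule 7 c5 s1 (fun l s' => reg s' 5 = b + (k * n + l) /\
    (X < k \/ X = k /\ Y < l -> reg s' r = b + (X * n + Y))).
rewrite -/c7 s1n in H; have [] := H.
- by rewrite /c5 /= !orbF eq_sym r7.
- split=> /=; first by rewrite s15 addn0.
  by case=> [Xk|[] //]; rewrite r7 s1r.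
- move=> {H} l s2 ln [a2 _ _] s27 [s25 s2r].
  have s2x : reg s2 x = X by rewrite a2 /c5 //= x5 x7 xnr.
  have s2y : reg s2 y = Y by rewrite a2 /c5 //= y5 y7 ynr.
  have s26 : reg s2 6 = k by rewrite a2 /c5 //= [6 == r]eq_sym r6.
  rewrite /c5 !evalE !condR // s2x s2y s26 s27.
  case: eqP => [kX|kX]; first case: eqP => [lY|lY].
  + split=> /=; first by rewrite [5 == r]eq_sym r5 /= s25; lia.
    by rewrite r5 r7 eqxx s25 -kX -lY.
  + split=> /=; first by rewrite s25; lia.
    by rewrite r5 r7 => h; apply: s2r; lia.
  + split=> /=; first by rewrite s25; lia.
    by rewrite r5 r7 => h; apply: s2r; lia.
- move=> h1 h2; split=> /=; first by rewrite h1 mulSn; lia.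
  by rewrite r6 ltnS => Xk; apply: h2; lia.
Qed.

Lemma agree_for_trans i c s s1 s2 :
  agree (Cfor i c) s s1 -> agree c s1 s2 -> agree (Cfor i c) s s2.
Proof.
case=> a1 a2 a3 [b1 b2 b3]; split=> [r|t p|] /= h.
- by rewrite b1 ?a1 //; move: h; rewrite negb_or => /andP[].
- by rewrite b2 ?a2.
- by rewrite b3 ?a3.
Qed.

Definition matrix_cmd c := Cfor 8 (Cfor 9 (index_cmd 8 9 11 ;+ c)).

(** One invariant indexed by the number of entries treated replaces those of the two nested loops.
    The premise on [s1] and [s2] lets it survive the changes of counters and scratch registers
    between entries. *)
Lemma matrix_rule c s n (Q : nat -> store -> Prop) : reg s 1 = n ->
  all (fun r => ~~ modR r c) [:: 1; 2; 8; 9] ->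
  (forall k s1 s2, (forall r, r \notin [:: 5; 6; 7; 8; 9; 11] -> reg s2 r = reg s1 r) ->
     (forall t p, arr s2 t p = arr s1 t p) -> Q k s1 -> Q k s2) ->
  Q 0 s ->
  (forall (x y : 'I_n) s', agree (matrix_cmd c) s s' -> reg s' 8 = x -> reg s' 9 = y ->
     reg s' 11 = reg s 2 + (x * n + y) -> Q (x * n + y) s' -> Q (x * n + y).+1 (eval c s')) ->
  Q (n * n) (eval (matrix_cmd c) s).
Proof.
move=> sn /and5P[/negbTE m1 /negbTE m2 /negbTE m8 /negbTE m9 _] ins Q0 QS.
have insR r v k s' : r \in [:: 5; 6; 7; 8; 9; 11] -> Q k s' -> Q k (setR r v s').
  move=> rr; apply: (ins) => // r' h /=; case: eqP => // E; by rewrite E rr in h.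
rewrite /matrix_cmd; set c9 := Cfor 9 _; rewrite -{1}sn.
apply: (@for_rule 8 c9 s (fun k s' => Q (k * n) s')).
- by rewrite /= m8.
- exact: insR.
move=> k s1; rewrite sn => kn A1 s18 Q1; apply: (insR) => //.
have [a1 a2 _] := A1.
have s1n : reg s1 1 = n by rewrite a1 //= m1.
have -> : k.+1 * n = k * n + reg s1 1 by rewrite s1n mulSn addnC.
apply: (@for_rule 9 _ s1 (fun l s' => Q (k * n + l) s')).
- by rewrite /= m9.
- by rewrite addn0; apply: (insR).
move=> l s2; rewrite s1n => ln A2 s29 Q2; rewrite addnS; apply: (insR) => //.
have [b1 b2 _] := A2.
have s28 : reg s2 8 = k by rewrite b1 //= m8.
have s2n : reg s2 1 = n by rewrite b1 //= m1.
rewrite eval_seq; set s3 := eval (index_cmd _ _ _) s2.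
have s3A : agree (index_cmd 8 9 11 ;+ c) s2 s3.
  have [c1 c2 c3] := agree_eval (index_cmd 8 9 11) s2; split=> [r|t p|] h.
  - by apply: c1; move: h; rewrite -[modR r _]/(modR r (index_cmd 8 9 11) || modR r c) negb_or => /andP[].
  - by apply: c2.
  - by apply: c3.
apply: (QS (Ordinal kn) (Ordinal ln)).
- exact: agree_for_trans A1 (agree_for_trans A2 s3A).
- by rewrite /s3 eval_reg.
- by rewrite /s3 eval_reg.
- rewrite /s3 eval_index ?s28 ?s29 ?s2n //; congr (_ + _).
  by rewrite b1 ?a1 //= m2.
apply: (ins) Q2 => [r h|t p]; last by rewrite /s3 eval_arr.
move: h; rewrite !inE !negb_or => /andP[/negbTE h5 /andP[/negbTE h6 /andP[/negbTE h7]]].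
case/andP=> _ /andP[_ /negbTE h11].
by rewrite /s3 eval_reg //= h5 h6 h7 h11.
Qed.

Definition mat n b s t (x y : 'I_n) := arr s t (b + (x * n + y)).

Lemma enc_inj n (x y u v : 'I_n) : (x * n + y == u * n + v) = (x == u) && (y == v).
Proof.
have n0 : 0 < n by apply: leq_ltn_trans (ltn_ord x).
rewrite -!val_eqE /=; apply/eqP/andP => [h|[/eqP -> /eqP ->] //].
have := congr1 (divn^~ n) h; rewrite !divnMDl // !divn_small // !addn0 => xu.
by split; [apply/eqP | move: h; rewrite xu => /addnI/eqP].
Qed.

Lemma enc_lt n (x y : 'I_n) : x * n + y < n * n.
Proof.
have := ltn_ord x; have := ltn_ord y => yn xn.
by apply: (@leq_trans (x.+1 * n)); [rewrite mulSn; lia|rewrite leq_mul2r xn orbT].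
Qed.

Lemma card_ord_recr n (p : pred 'I_n) (k : 'I_n) :
  #|[set z : 'I_n | p z & z < k.+1]| = #|[set z : 'I_n | p z & z < k]| + p k.
Proof.
rewrite (cardsD1 k) inE ltnSn andbT addnC; congr (_ + _).
apply: eq_card => z; rewrite !inE ltnS [z <= k]leq_eqVlt -val_eqE /=.
by case: ltngtP; rewrite ?andbF.
Qed.

Lemma card_ord_all n (p : pred 'I_n) : #|[set z : 'I_n | p z & z < n]| = #|[set z | p z]|.
Proof. by apply: eq_card => z; rewrite !inE ltn_ord andbT. Qed.

Lemma card_ord_none n (p : pred 'I_n) : #|[set z : 'I_n | p z & z < 0]| = 0.
Proof. by apply: eq_card0 => z; rewrite !inE andbF. Qed.

Definition diff_body :=
  index_cmd 9 8 12 ;+ Cset 11 tH false ;+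
  Cif 11 tIN (Cif 11 tS Cnop (Cif 12 tS Cnop (Cset 11 tH true))) Cnop.

Lemma eval_diff n s (x y : 'I_n) : reg s 1 = n -> let b := reg s 2 in
  mat b (eval (matrix_cmd diff_body) s) tH x y =
  [&& mat b s tIN x y, ~~ mat b s tS x y & ~~ mat b s tS y x].
Proof.
move=> sn b.
pose Q k s' := forall x y : 'I_n, x * n + y < k -> mat b s' tH x y =
  [&& mat b s tIN x y, ~~ mat b s tS x y & ~~ mat b s tS y x].
suff : Q (n * n) (eval (matrix_cmd diff_body) s) by apply; apply: enc_lt.
apply: (matrix_rule sn) => //.
- by move=> k s1 s2 _ hA Q1 u v uv; rewrite /mat hA; apply: Q1.
move=> {}x {}y s1 [a1 a2 _] s18 s19 s111 Q1 u v; rewrite ltnS leq_eqVlt enc_inj => uv.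
rewrite /diff_body eval_seq; set s2 := eval (index_cmd _ _ _) s1.
have s212 : reg s2 12 = b + (y * n + x).
  by rewrite /s2 eval_index ?s18 ?s19 ?a1 ?sn.
have s211 : reg s2 11 = b + (x * n + y) by rewrite /s2 eval_reg.
have s2A t p : t != tH -> arr s2 t p = arr s t p.
  by move=> tne; rewrite /s2 eval_arr // a2 //= (negbTE tne).
have s2H p : arr s2 tH p = arr s1 tH p by rewrite /s2 eval_arr.
rewrite !evalE !condA //= s211 !s2A //= s212.
case/orP: uv => [/andP[/eqP -> /eqP ->]|uv].
  rewrite /mat; case: (arr s tIN _); case: (arr s tS (b + (x * n + y)));
    by case: (arr s tS (b + (y * n + x))); rewrite /= eqxx.
have ne : (b + (u * n + v) == b + (x * n + y)) = false by rewrite eqn_add2l ltn_eqF.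
by rewrite -(Q1 _ _ uv) /mat; do 3?[case: ifP => _]; rewrite /= ?ne s2H.
Qed.

Definition deg_loop :=
  Cfor 10 (index_cmd 8 10 11 ;+ Cif 11 tH (Cinc 13) Cnop ;+
           index_cmd 9 10 12 ;+ Cif 12 tH (Cinc 14) Cnop).

Lemma eval_deg n s (x y : 'I_n) : reg s 1 = n -> reg s 8 = x -> reg s 9 = y ->
  reg s 13 = 0 -> reg s 14 = 0 -> let b := reg s 2 in
  reg (eval deg_loop s) 13 = #|[set z | mat b s tH x z]| /\
  reg (eval deg_loop s) 14 = #|[set z | mat b s tH y z]|.
Proof.
move=> s1 s8 s9 s13 s14 b.
have := @for_rule 10 _ s (fun k s' =>
  reg s' 13 = #|[set z : 'I_n | mat b s tH x z & z < k]| /\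
  reg s' 14 = #|[set z : 'I_n | mat b s tH y z & z < k]|).
rewrite s1 !card_ord_all; apply=> //; first by rewrite !card_ord_none.
move=> k s2 kn [a1 a2 _] s210 [h13 h14].
have s28 : reg s2 8 = x by rewrite a1.
have s29 : reg s2 9 = y by rewrite a1.
have s21 : reg s2 1 = n by rewrite a1.
have s22 : reg s2 2 = b by rewrite a1.
pose z := Ordinal kn.
rewrite eval_seq; set s3 := eval (index_cmd _ _ _) s2.
have s311 : reg s3 11 = b + (x * n + z) by rewrite /s3 eval_index ?s28 ?s210 ?s21 ?s22.
rewrite eval_seq; set s4 := eval (Cif _ _ _ _) s3.
have s413 : reg s4 13 = reg s2 13 + mat b s tH x z.
  rewrite /s4 !evalE condA // s311 {1}/s3 eval_arr // a2 // -/(mat b s tH x z).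
  by case: (mat _ _ _ _ _); rewrite /= /s3 eval_reg // ?addn1 ?addn0.
rewrite eval_seq; set s5 := eval (index_cmd _ _ _) s4.
have s512 : reg s5 12 = b + (y * n + z).
  by rewrite /s5 eval_index /s4 ?eval_reg /s3 ?eval_reg // ?s29 ?s210 ?s21 ?s22.
rewrite !evalE condA // s512 {1}/s5 eval_arr // {1}/s4 eval_arr // {1}/s3 eval_arr //.
rewrite a2 // -/(mat b s tH y z).
have h13' : reg s5 13 = #|[set z : 'I_n | mat b s tH x z & z < k.+1]|.
  by rewrite /s5 eval_reg // s413 h13 (card_ord_recr _ z).
have h14' : reg s5 14 = #|[set z : 'I_n | mat b s tH y z & z < k]|.
  by rewrite /s5 eval_reg // /s4 eval_reg // /s3 eval_reg.
rewrite (card_ord_recr (mat b s tH y) z) -h14'.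
by case: (mat b s tH y z); split; rewrite //= ?addn1 ?addn0.
Qed.

Definition check_body :=
  Cif 11 tH (Ccopy 13 0 ;+ Ccopy 14 0 ;+ deg_loop ;+ Cif 13 14 (Cset 0 fOK false) Cnop) Cnop.
Definition check_cmd := Cset 0 fOK true ;+ matrix_cmd check_body.

Lemma eval_check n s : reg s 0 = 0 -> reg s 1 = n -> let b := reg s 2 in
  arr (eval check_cmd s) fOK 0 = [forall x : 'I_n, forall y : 'I_n, mat b s tH x y ==>
    (#|[set z | mat b s tH x z]| != #|[set z | mat b s tH y z]|)].
Proof.
move=> s0 s1 b; rewrite /check_cmd !evalE s0; set s2 := setA _ _ _ s.
pose P (x y : 'I_n) := mat b s tH x y ->
    #|[set z | mat b s tH x z]| != #|[set z | mat b s tH y z]|.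
pose Q k s' := arr s' fOK 0 <-> forall x y : 'I_n, x * n + y < k -> P x y.
suff : Q (n * n) (eval (matrix_cmd check_body) s2).
  move=> h; apply/idP/forallP => [/h H x|H].
    by apply/forallP => y; apply/implyP; apply: H; apply: enc_lt.
  by apply/h => x y _; have /forallP/(_ y)/implyP := H x.
apply: (@matrix_rule _ s2 n) => //.
  by move=> k s3 s4 _ hA Q1; rewrite /Q hA.
move=> x y s3 [a1 a2 _] s38 s39 s311 Q1.
have s3A t p : t != fOK -> arr s3 t p = arr s t p.
  by move=> tne; rewrite a2 //= ?orbF ?(negbTE tne).
(* The flag is only ever cleared, so treating an entry amounts to a conjunction with the condition
   at this entry. *)
have QS (v : bool) s4 : (v <-> P x y) -> arr s4 fOK 0 = arr s3 fOK 0 && v ->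
    Q (x * n + y).+1 s4.
  move=> vP E; rewrite /Q E; split=> [/andP[/Q1 H /vP Pxy] u w|H].
    rewrite ltnS leq_eqVlt enc_inj => /orP[/andP[/eqP -> /eqP ->] //|]; exact: H.
  apply/andP; split; last by apply/vP/H.
  by apply/Q1 => u w uw; apply: H; apply: ltnW.
rewrite /check_body eval_if condA // s311 s3A //= -/(mat b s tH x y).
case: ifP => xy; last first.
  by apply: (QS true); rewrite ?evalE ?andbT // /P xy.
rewrite !eval_seq !eval_copy; set s4 := setR 14 _ _.
have s30 : reg s3 0 = 0 by rewrite a1.
have := @eval_deg n s4 x y; rewrite /= a1 //= s38 s39 s30 => /(_ s1 erefl erefl erefl erefl).
have -> : reg s3 2 = b by rewrite a1.
have E (w : 'I_n) : #|[set z | mat b s4 tH w z]| = #|[set z | mat b s tH w z]|.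
  by apply: eq_card => z; rewrite !inE /mat /= s3A.
rewrite !E => -[d1 d2].
set s5 := eval deg_loop s4 in d1 d2 *.
have s50 : reg s5 0 = 0 by rewrite /s5 eval_reg.
apply: (QS (reg s5 13 != reg s5 14)); first by rewrite d1 d2 /P xy; split=> // ->.
rewrite !evalE condR //; case: eqP => _ /=.
  by rewrite s50 andbF.
by rewrite andbT /s5 eval_arr.
Qed.

Definition twin_cmd :=
  Cset 0 fTW true ;+
  Cfor 10 (index_cmd 8 10 11 ;+ index_cmd 9 10 12 ;+
    Cif 11 tIN (Cif 12 tIN Cnop (Cset 0 fTW false)) (Cif 12 tIN (Cset 0 fTW false) Cnop)).

Lemma eval_twin n s (u v : 'I_n) : reg s 0 = 0 -> reg s 1 = n -> reg s 8 = v -> reg s 9 = u ->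
  let b := reg s 2 in
  arr (eval twin_cmd s) fTW 0 = [forall z, mat b s tIN u z == mat b s tIN v z].
Proof.
move=> s0 s1 s8 s9 b; rewrite /twin_cmd eval_seq eval_set s0; set s2 := setA _ _ _ s.
pose P (z : 'I_n) := mat b s tIN u z == mat b s tIN v z.
pose Q k s' := arr s' fTW 0 <-> forall z : 'I_n, z < k -> P z.
suff : Q n (eval (Cfor 10 (index_cmd 8 10 11 ;+ index_cmd 9 10 12 ;+
    Cif 11 tIN (Cif 12 tIN Cnop (Cset 0 fTW false)) (Cif 12 tIN (Cset 0 fTW false) Cnop))) s2).
  move=> h; apply/idP/forallP => [/h H x|H]; first exact: H.
  by apply/h => z _; apply: H.
rewrite -{1}s1; apply: (@for_rule _ _ s2) => //.
rewrite [reg _ 1]s1 => k s3 kn [a1 a2 _] s310 Q1.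
have s38 : reg s3 8 = v by rewrite a1.
have s39 : reg s3 9 = u by rewrite a1.
have s31 : reg s3 1 = n by rewrite a1.
have s32 : reg s3 2 = b by rewrite a1.
have s30 : reg s3 0 = 0 by rewrite a1.
pose z := Ordinal kn.
rewrite eval_seq; set s4 := eval (index_cmd _ _ _) s3.
have s411 : reg s4 11 = b + (v * n + z) by rewrite /s4 eval_index ?s38 ?s310 ?s31 ?s32.
rewrite eval_seq; set s5 := eval (index_cmd _ _ _) s4.
have s512 : reg s5 12 = b + (u * n + z).
  by rewrite /s5 eval_index /s4 ?eval_reg ?s39 ?s310 ?s31 ?s32.
have s511 : reg s5 11 = b + (v * n + z) by rewrite /s5 eval_reg.
have s50 : reg s5 0 = 0 by rewrite /s5 eval_reg // /s4 eval_reg.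
have s5A t p : arr s5 t p = arr s3 t p by rewrite /s5 eval_arr // /s4 eval_arr.
have s3I p : arr s3 tIN p = arr s tIN p by rewrite a2.
have QS s6 : arr s6 fTW 0 = arr s3 fTW 0 && P z -> Q k.+1 s6.
  move=> E; rewrite /Q E; split=> [/andP[/Q1 H Pz] w|H].
    rewrite ltnS leq_eqVlt => /orP[/eqP wk|]; last exact: H.
    by rewrite (_ : w = z) //; apply: val_inj.
  apply/andP; split; last exact: H.
  by apply/Q1 => w wk; apply: H; apply: ltnW.
apply: QS; rewrite /P !evalE !condA // s511 s512 !s5A !s3I /mat.
case: (arr s tIN (b + (v * n + z))); case: (arr s tIN (b + (u * n + z)));
  by rewrite /= ?s50 ?eqxx ?s5A ?andbT ?andbF.
Qed.

(** Registers can be compared for equality only. Therefore u < v is kept as a flag that is cleared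
    when u reaches v, and the count saturates at 2s, which turns rank < 2s into a disequality. *)
Definition rank_body :=
  Cif 9 8 (Cset 0 fLT false) Cnop ;+
  Cif 0 fLT (twin_cmd ;+ Cif 0 fTW (Cif 15 r2S Cnop (Cinc 15)) Cnop) Cnop.
Definition rank_cmd := Ccopy 15 0 ;+ Cset 0 fLT true ;+ Cfor 9 rank_body.

Lemma eval_rank n s (v : 'I_n) : reg s 0 = 0 -> reg s 1 = n -> reg s 8 = v ->
  let b := reg s 2 in
  reg (eval rank_cmd s) 15 = minn #|[set u : 'I_n | (u < v) &&
    [forall z, mat b s tIN u z == mat b s tIN v z]]| (reg s r2S).
Proof.
move=> s0 s1 s8 b; rewrite /rank_cmd !eval_seq eval_copy eval_set s0 [reg _ 0]s0.
set s2 := setA _ _ _ _.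
pose p (u : 'I_n) := (u < v) && [forall z, mat b s tIN u z == mat b s tIN v z].
have := @for_rule 9 rank_body s2 (fun k s' => arr s' fLT 0 = (k <= v) /\
  reg s' 15 = minn #|[set u : 'I_n | p u & u < k]| (reg s r2S)).
rewrite [reg s2 1]s1 card_ord_all => H; apply: (fun X Y Z => proj2 (H X Y Z)) => //.
  by rewrite card_ord_none min0n.
move=> {H} k s3 kn [a1 a2 _] s39 [hLT h15].
have s38 : reg s3 8 = v by rewrite a1.
have s31 : reg s3 1 = n by rewrite a1.
have s32 : reg s3 2 = b by rewrite a1.
have s30 : reg s3 0 = 0 by rewrite a1.
have s34 : reg s3 4 = reg s 4 by rewrite a1.
have s3I q : arr s3 tIN q = arr s tIN q by rewrite a2.
pose u := Ordinal kn.
rewrite /rank_body eval_seq; set s4 := eval (Cif 9 8 _ _) s3.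
have s4L : arr s4 fLT 0 = (k < v).
  rewrite /s4 !evalE condR // s39 s38; case: eqP => kv.
    by rewrite /= s30 kv ltnn.
  by rewrite hLT; lia.
have s4I q : arr s4 tIN q = arr s tIN q by rewrite /s4 eval_arr.
have s4E r : reg s4 r = reg s3 r by rewrite /s4 eval_reg.
rewrite eval_if condA // s4E s30 s4L (card_ord_recr p u) /p /=.
case: (ltnP k v) => kv /=; last by rewrite /= s4L s4E addn0 h15 ltnNge kv.
rewrite eval_seq; set s5 := eval twin_cmd s4.
have := @eval_twin n s4 u v; rewrite /= !s4E => /(_ s30 s31 s38 s39); rewrite -/s5 s32.
have -> : [forall z, mat b s4 tIN u z == mat b s4 tIN v z] =
  [forall z, mat b s tIN u z == mat b s tIN v z].
  by apply: eq_forallb => z; rewrite /mat !s4I.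
move=> hTW.
have s5L : arr s5 fLT 0 = true by rewrite /s5 eval_arr // s4L.
have s5E r : ~~ modR r twin_cmd -> reg s5 r = reg s3 r by move=> h; rewrite /s5 eval_reg.
rewrite !evalE condA // (s5E 0) // s30 hTW.
case: [forall z, _]; last by rewrite addn0 /= (s5E 15) // s5L h15.
rewrite condR // !s5E // h15 s34 addn1.
set c := #|_|; case: (ltnP c (reg s 4)) => ch.
  by rewrite (minn_idPl ch) ltn_eqF //= s5L s5E // h15 -/c (minn_idPl (ltnW ch)).
rewrite eqxx s5L s5E // h15 -/c (minn_idPr ch) (minn_idPr _) //.
exact: leq_trans ch (leqnSn _).
Qed.

Definition vertex_body := rank_cmd ;+ Cif 15 r2S (Cset 8 tV false) (Cset 8 tV true).
Definition pair_body :=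
  Cset 11 tA false ;+ Cif 11 tIN (Cif 8 tV (Cif 9 tV (Cset 11 tA true) Cnop) Cnop) Cnop.
Definition allowed_cmd := Cfor 8 vertex_body ;+ matrix_cmd pair_body.

Lemma eval_vertices n s (v : 'I_n) : reg s 0 = 0 -> reg s 1 = n ->
  let b := reg s 2 in
  arr (eval (Cfor 8 vertex_body) s) tV v = (#|[set u : 'I_n | (u < v) &&
    [forall z, mat b s tIN u z == mat b s tIN v z]]| < reg s r2S).
Proof.
move=> s0 s1 b.
pose Q k s' := forall v : 'I_n, v < k -> arr s' tV v = (#|[set u : 'I_n | (u < v) &&
    [forall z, mat b s tIN u z == mat b s tIN v z]]| < reg s r2S).
suff : Q n (eval (Cfor 8 vertex_body) s) by apply.
rewrite -{1}s1; apply: for_rule => // k s3; rewrite s1 => kn [a1 a2 _] s38 Q1.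
have s31 : reg s3 1 = n by rewrite a1.
have s32 : reg s3 2 = b by rewrite a1.
have s30 : reg s3 0 = 0 by rewrite a1.
have s34 : reg s3 4 = reg s 4 by rewrite a1.
have s3I q : arr s3 tIN q = arr s tIN q by rewrite a2.
rewrite /vertex_body eval_seq; set s4 := eval rank_cmd s3.
have := @eval_rank n s3 (Ordinal kn) s30 s31 s38; rewrite -/s4 s32 s34 => h15.
have s44 : reg s4 4 = reg s 4 by rewrite /s4 eval_reg.
have s48 : reg s4 8 = k by rewrite /s4 eval_reg.
move=> w; rewrite ltnS leq_eqVlt => wk.
have E : arr (incR 8 (eval (Cif 15 4 (Cset 8 tV false) (Cset 8 tV true)) s4)) tV w =
    if val w == k then reg s4 15 != reg s 4 else arr s3 tV w.
  rewrite !evalE condR // s44; case: eqP => h; rewrite /= s48;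
    by case: eqP => // _; rewrite /s4 eval_arr.
rewrite E; case/orP: wk => [/eqP wk|wk]; last by rewrite ltn_eqF // Q1.
have -> : w = Ordinal kn by apply: val_inj.
rewrite eqxx h15; set c := #|[set u : 'I_n | (u < Ordinal kn) && _]|.
have -> : c = #|[set u : 'I_n | (u < Ordinal kn) &&
    [forall z, mat b s tIN u z == mat b s tIN (Ordinal kn) z]]|.
  apply: eq_card => x; rewrite !inE; congr andb; apply: eq_forallb => z.
  by rewrite /mat !s3I.
by rewrite ltnNge; case: leqP => h; case: eqP => //; lia.
Qed.

Lemma eval_pairs n s (x y : 'I_n) : reg s 1 = n -> let b := reg s 2 in
  mat b (eval (matrix_cmd pair_body) s) tA x y =
  [&& mat b s tIN x y, arr s tV x & arr s tV y].
Proof.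
move=> sn b.
pose Q k s' := forall x y : 'I_n, x * n + y < k -> mat b s' tA x y =
  [&& mat b s tIN x y, arr s tV x & arr s tV y].
suff : Q (n * n) (eval (matrix_cmd pair_body) s) by apply; apply: enc_lt.
apply: (matrix_rule sn) => //.
- by move=> k s1 s2 _ hA Q1 u v uv; rewrite /mat hA; apply: Q1.
move=> {}x {}y s1 [a1 a2 _] s18 s19 s111 Q1 u v; rewrite ltnS leq_eqVlt enc_inj => uv.
have s1I p : arr s1 tIN p = arr s tIN p by rewrite a2.
have s1V p : arr s1 tV p = arr s tV p by rewrite a2.
rewrite /pair_body !evalE !condA //= s111 s18 s19 s1I !s1V -/b.
case/orP: uv => [/andP[/eqP -> /eqP ->]|uv].
  rewrite /mat; case: (arr s tIN _); case: (arr s tV x);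
    by case: (arr s tV y); rewrite /= eqxx.
have ne : (b + (u * n + v) == b + (x * n + y)) = false by rewrite eqn_add2l ltn_eqF.
by rewrite -(Q1 _ _ uv) /mat; do 3?[case: ifP => _]; rewrite /= ?ne.
Qed.

Lemma eval_allowed n s (G : sgraph n) : reg s 0 = 0 -> reg s 1 = n ->
  let b := reg s 2 in (forall x y : 'I_n, mat b s tIN x y = adj G x y) ->
  forall k, reg s r2S = k.*2 -> forall x y : 'I_n,
  mat b (eval allowed_cmd s) tA x y = ((x, y) \in allowed_pairs G k).
Proof.
move=> s0 s1 b hG k sk x y; rewrite /allowed_cmd eval_seq.
set s2 := eval (Cfor 8 _) s.
have := @eval_pairs n s2 x y; rewrite /s2 !eval_reg // => ->; last exact: s1.
rewrite /mat eval_arr // -/(mat b s tIN x y) hG !inE /=.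
have V (v : 'I_n) : arr (eval (Cfor 8 vertex_body) s) tV v = (v \in allowed G k).
  rewrite eval_vertices // sk inE; congr (_ < _); apply: eq_card => u; rewrite !inE.
  by congr andb; apply: eq_forallb => z; rewrite !hG.
by rewrite !V !inE.
Qed.

(** The positions in the stored matrix also serve as the bit positions of the enumeration order, so
    that the carry moves along the storage. *)
Definition enc n (p : 'I_n * 'I_n) : nat := p.1 * n + p.2.

Lemma enc_injective n : injective (@enc n).
Proof.
move=> [x y] [u v] /eqP; rewrite /enc /= enc_inj => /andP[/eqP -> /eqP ->] //.
Qed.

Definition stores n b s t (S : {set 'I_n * 'I_n}) :=
  forall x y : 'I_n, mat b s t x y = ((x, y) \in S).

Definition count_cmd := Ccopy 15 0 ;+ matrix_cmd (Cif 11 tS (Cinc 15) Cnop).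

Lemma eval_count n s (S : {set 'I_n * 'I_n}) : reg s 0 = 0 -> reg s 1 = n ->
  stores (reg s 2) s tS S -> reg (eval count_cmd s) 15 = #|S|.
Proof.
move=> s0 s1 hS; rewrite /count_cmd eval_seq eval_copy s0; set s2 := setR 15 0 s.
pose Q k s' := reg s' 15 = #|[set p in S | enc p < k]|.
suff : Q (n * n) (eval (matrix_cmd (Cif 11 tS (Cinc 15) Cnop)) s2).
  by move=> ->; apply: eq_card => p; rewrite inE enc_lt andbT.
apply: (@matrix_rule _ s2 n) => //.
- by move=> k s3 s4 hR _; rewrite /Q hR.
- by rewrite /Q eq_card0 // => p; rewrite inE andbF.
move=> x y s3 [a1 a2 _] s38 s39 s311 Q1; rewrite /Q.
have -> : reg (eval (Cif 11 tS (Cinc 15) Cnop) s3) 15 = reg s3 15 + ((x, y) \in S).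
  rewrite !evalE condA // s311 a2 // -[arr s2 _ _]/(mat (reg s 2) s tS x y) hS.
  by case: (_ \in S); rewrite /= ?addn1 ?addn0.
rewrite Q1 (cardsD1 (x, y) [set p in S | enc p < (x * n + y).+1]) inE /enc /= ltnSn andbT addnC.
congr (_ + _); apply: eq_card => -[u v].
rewrite !inE /enc /= ltnS [u * n + v <= _]leq_eqVlt enc_inj xpair_eqE.
by case: eqVneq => [->|_] /=; [case: eqVneq => [->|_] //=; rewrite ltnn andbF|].
Qed.

(** The flag [fST] says that the carry has started, [fCA] that it has not stopped. If it never
    stops, all of S has been cleared, which is the set the next budget begins with. *)
Definition next_body :=
  Cif 11 tA (
    Cif 11 tS (Cset 0 fST true) Cnop ;+
    Cif 0 fST (Cif 0 fCA
      (Cif 11 tS (Cset 11 tS false) (Cset 11 tS true ;+ Cset 0 fCA false)) Cnop) Cnop) Cnop.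

Definition next_cmd :=
  count_cmd ;+ Cif 15 rS (Cset 0 fST false) (Cset 0 fST true) ;+ Cset 0 fCA true ;+
  matrix_cmd next_body.

(** Identifies the stopping place chosen by [pick] in [next_set] with the one found by the sweep. *)
Lemma carry_stop_unique (T : finType) (f : T -> nat) k (AL S : {set T}) p q : injective f ->
  carry_stop f k AL S p -> carry_stop f k AL S q -> p = q.
Proof.
move=> fI /and4P[pA pS pc /forallP hp] /and4P[qA qS qc /forallP hq].
case: (ltngtP (f p) (f q)) => pq; last exact: fI.
- by have := hq p; rewrite pA pq pc (negbTE pS).
- by have := hp q; rewrite qA pq qc (negbTE qS).
Qed.

Lemma eval_next n s k (AL S : {set 'I_n * 'I_n}) : reg s 0 = 0 -> reg s 1 = n -> reg s rS = k ->
  let b := reg s 2 in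
  stores b s tS S -> stores b s tA AL -> S \subset AL ->
  let s' := eval next_cmd s in
  if next_set (@enc n) k AL S is Some S' then ~~ arr s' fCA 0 /\ stores b s' tS S'
  else arr s' fCA 0 /\ stores b s' tS (set0 : {set 'I_n * 'I_n}).
Proof.
move=> s0 s1 sk b hS hA /subsetP SA; rewrite /= /next_cmd !eval_seq.
set s2 := eval count_cmd s.
have s20 : reg s2 0 = 0 by rewrite /s2 eval_reg.
have s23 : reg s2 3 = k by rewrite /s2 eval_reg.
have s215 : reg s2 15 = #|S| by apply: eval_count.
rewrite eval_if condR // s215 s23 !eval_set.
set s3 := if _ then _ else _; set s4 := setA _ _ _ s3.
have s3R r : reg s3 r = reg s2 r by rewrite /s3; case: ifP.
have s4R r : reg s4 r = reg s2 r by rewrite /s4 /= s3R.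
have s4A t p : t < fST -> arr s4 t p = arr s t p.
  move=> tf; rewrite /s4 /= ifF; last by lia.
  rewrite (_ : arr s3 t p = arr s2 t p); first by rewrite /s2 eval_arr.
  by rewrite /s3; case: ifP => _ /=; rewrite ifF //; lia.
have s4C : arr s4 fCA 0 by rewrite /s4 /= s3R s20.
have s4S : arr s4 fST 0 = (#|S| != k).
  by rewrite /s4 /s3 /=; case: eqP; rewrite /= s20.
have s41 : reg s4 1 = n by rewrite s4R /s2 eval_reg.
have s42 : reg s4 2 = b by rewrite s4R /s2 eval_reg.
pose start i := (#|S| != k) || [exists q in S, enc q < i].
(* Either the carry is alive: the entries below i are cleared, the others untouched, and every
   carried position passed so far was a one. Or it has stopped and the final set is in place. *)
pose Q i s' :=
  [/\ arr s' fCA 0, arr s' fST 0 = start i,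
      forall x y : 'I_n, mat b s' tS x y = ((x, y) \in S) && (i <= x * n + y) &
      forall e, e \in AL -> enc e < i -> carried (@enc n) k S e -> e \in S] \/
  arr s' fCA 0 = false /\ exists2 p, carry_stop (@enc n) k AL S p &
    stores b s' tS (carry_set (@enc n) S p).
have QE : Q (n * n) (eval (matrix_cmd next_body) s4).
  apply: (matrix_rule s41) => //.
  - move=> i s5 s6 hR hAr; rewrite /Q /stores /mat !hAr.
    case=> [[h1 h2 h3 h4]|[h1 [p h2 h3]]]; [left; split=> // u v | right; split=> //; exists p => // u v];
      by rewrite hAr; [apply: h3].
  - left; split=> //.
    + by rewrite s4S /start; case: existsP => [[q /andP[_]]//|]; rewrite orbF.
    + by move=> x y; rewrite andbT -hS /mat s4A.
  move=> x y s5 [a1 a2 _] s58 s59 s511 Q1.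
  pose e := (x, y).
  have s50 : reg s5 0 = 0 by rewrite a1 // s4R.
  have s5A : arr s5 tA (b + (x * n + y)) = (e \in AL) by rewrite a2 // s4A // -hA.
  rewrite s42 in s511.
  have startS : start (x * n + y).+1 = start (x * n + y) || (e \in S).
    rewrite /start -orbA; congr orb; apply/existsP/orP.
      case=> -[u v] /andP[qS]; rewrite /enc /= ltnS leq_eqVlt enc_inj.
      case/orP=> [/andP[/eqP uE /eqP vE]|h]; first by right; rewrite /e -uE -vE.
      by left; apply/existsP; exists (u, v); rewrite qS.
    case=> [/existsP[q /andP[qS h]]|eS]; [exists q | exists e].
      by rewrite qS /= ltnS ltnW.
    by rewrite eS /= /enc /=.
  have carryE : carried (@enc n) k S e = start (x * n + y).+1.
    by rewrite /carried /start; congr orb; apply: eq_existsb => q; rewrite ltnS.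
  have ne (u v : 'I_n) : (b + (u * n + v) == b + (x * n + y)) = ((u, v) == e).
    by rewrite eqn_add2l enc_inj xpair_eqE.
  rewrite /next_body eval_if condA // s511 s5A.
  case: Q1 => [[C1 ST1 S1 F1]|[C0 [p pS S1]]]; last first.
    right; case: ifP => eA; last by rewrite eval_nop; split=> //; exists p.
    rewrite eval_seq; set s6 := eval (Cif 11 tS _ _) s5.
    have s6C : arr s6 fCA 0 = false by rewrite /s6 eval_arr.
    have s60 : reg s6 0 = 0 by rewrite /s6 eval_reg.
    rewrite !evalE !condA // !s60 s6C if_same; split=> //; exists p => // u v.
    by rewrite -S1 /mat /s6 eval_arr.
  have S1e : arr s5 tS (b + (x * n + y)) = (e \in S) by rewrite -/(mat b s5 tS x y) S1 leqnn andbT.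
  have S1' (u v : 'I_n) : (u, v) != e ->
      mat b s5 tS u v = ((u, v) \in S) && ((x * n + y).+1 <= u * n + v).
    by move=> uv; rewrite S1 [x * n + y < _]ltn_neqAle [_ == u * n + v]eq_sym enc_inj -xpair_eqE uv.
  case: ifP => eA; last first.
    have eS : e \in S = false by apply/negbTE; apply: contraFN eA; apply: SA.
    left; rewrite eval_nop; split=> //.
    + by rewrite ST1 startS eS orbF.
    + move=> u v; case: (eqVneq (u, v) e) => [[-> ->]|/S1' //].
      by rewrite S1 -/e eS.
    + move=> [u v] fA; rewrite /enc /= ltnS leq_eqVlt enc_inj.
      case/orP=> [/andP[/eqP uE /eqP vE]|]; last exact: (F1 (u, v) fA).
      by rewrite uE vE -/e eA in fA.
  rewrite eval_seq; set s6 := eval (Cif 11 tS _ _) s5.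
  have s60 : reg s6 0 = 0 by rewrite /s6 eval_reg.
  have s611 : reg s6 11 = b + (x * n + y) by rewrite /s6 eval_reg.
  have s6C : arr s6 fCA 0 by rewrite /s6 eval_arr.
  have s6S p : arr s6 tS p = arr s5 tS p by rewrite /s6 eval_arr.
  have s6T : arr s6 fST 0 = start (x * n + y).+1.
    rewrite /s6 !evalE condA // s511 S1e startS -ST1.
    by case: (e \in S) => /=; rewrite ?s50 ?orbT ?orbF.
  rewrite !evalE !condA // s60 s611 s6T s6C s6S S1e.
  case: ifP => st; last first.
    left; split=> // [u v|[u v] fA].
      case: (eqVneq (u, v) e) => [[-> ->]|/S1']; last by rewrite /mat s6S.
      rewrite /mat s6S S1e ltnn andbF; move: st; rewrite startS.
      by case: (e \in S) => //; rewrite orbT.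
    rewrite /enc /= ltnS leq_eqVlt enc_inj.
    case/orP=> [/andP[/eqP -> /eqP ->]|]; last exact: (F1 (u, v) fA).
    by rewrite -/e carryE st.
  case: ifP => eS.
    left; split=> [||u v|[u v] fA] //=.
      rewrite /mat /= ?s611 ne s6S; case: eqVneq => [[-> ->]|/S1' //].
      by rewrite ltnn andbF.
    rewrite /enc /= ltnS leq_eqVlt enc_inj.
    case/orP=> [/andP[/eqP -> /eqP ->]|]; last exact: (F1 (u, v) fA).
    by [].
  right; split; first by rewrite /= ?s60.
  exists e.
    rewrite /carry_stop eA eS carryE st /=; apply/forallP => f.
    by apply/implyP => fA; apply/implyP => fe; apply/implyP => fc; apply: F1.
  move=> u v; rewrite /mat /= ?s611 ne s6S inE.
  case: eqVneq => //= uv; rewrite -/(mat b s5 tS u v) S1' //.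
  by rewrite andbC.
rewrite /next_set; case: QE => [[C1 _ S1 F1]|[C0 [p pS S1]]].
  case: pickP => /= [p /and4P[pA /negP pS pc _]|_].
    by case: pS; apply: F1; rewrite ?enc_lt.
  split=> // x y; rewrite S1 inE leqNgt enc_lt andbF //.
case: pickP => /= [q qS|/(_ p)]; last by rewrite pS.
by rewrite C0; split=> // x y; rewrite S1 (carry_stop_unique (@enc_injective n) pS qS).
Qed.

(** The budget is kept in two forms: as a register, to be compared with |S|, and as the binary
    output, incremented along with it. Thus the answer needs no conversion when the search ends. *)
Definition body_cmd :=
  matrix_cmd diff_body ;+ check_cmd ;+
  Cif 0 fOK Cnop
    (next_cmd ;+ Cif 0 fCA (Cinc rS ;+ Cinc r2S ;+ Cinc r2S ;+ Cout ;+ allowed_cmd) Cnop).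

Lemma wf_body : wf body_cmd. Proof. by vm_compute. Qed.

Record search_state n (G : sgraph n) (c : nat * {set 'I_n * 'I_n}) s : Prop := SearchState {
  ss_zero : reg s 0 = 0;
  ss_n : reg s 1 = n;
  ss_budget : reg s rS = c.1;
  ss_budget2 : reg s r2S = c.1.*2;
  ss_out : out s = c.1;
  ss_adj : forall x y : 'I_n, mat (reg s 2) s tIN x y = adj G x y;
  ss_set : stores (reg s 2) s tS c.2;
  ss_allowed : stores (reg s 2) s tA (allowed_pairs G c.1) }.

Lemma eval_body n (G : sgraph n) c s :
  search_state G c s -> c.2 \subset allowed_pairs G c.1 ->
  arr (eval body_cmd s) fOK 0 = locally_irregular_del G c.2 /\
  (if locally_irregular_del G c.2 then out (eval body_cmd s) = c.1
   else search_state G (search_step (@enc n) (allowed_pairs G) c) (eval body_cmd s)).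
Proof.
case: c => k S /= [s0 s1 s3 s4 so hG hS hA] SA; rewrite /= in s3 s4 so hS hA.
set b := reg s 2 in hG hS hA.
rewrite /body_cmd !eval_seq; set t1 := eval (matrix_cmd diff_body) s.
have t1H x y : mat b t1 tH x y = adj_del G S x y.
  by rewrite /t1 eval_diff // hG !hS /adj_del andbA.
set t2 := eval check_cmd t1.
have t2R r : ~~ modR r (matrix_cmd diff_body) -> ~~ modR r check_cmd -> reg t2 r = reg s r.
  by move=> h1 h2; rewrite /t2 eval_reg // /t1 eval_reg.
have t2A t p : ~~ modA t (matrix_cmd diff_body) -> ~~ modA t check_cmd -> arr t2 t p = arr s t p.
  by move=> h1 h2; rewrite /t2 eval_arr // /t1 eval_arr.
have t2OK : arr t2 fOK 0 = locally_irregular_del G S.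
  rewrite /t2 (@eval_check n) /t1 ?eval_reg // -/t1 -/b.
  apply: eq_forallb => x; apply: eq_forallb => y; rewrite t1H; congr (_ ==> (_ != _)).
    by apply: eq_card => z; rewrite !inE t1H.
  by apply: eq_card => z; rewrite !inE t1H.
have t2o : out t2 = k by rewrite /t2 eval_out // /t1 eval_out.
rewrite eval_if condA // t2R // s0 t2OK; case: ifP => irr.
  by rewrite eval_nop t2OK.
rewrite eval_seq; set t3 := eval next_cmd t2.
have t3R r : ~~ modR r (matrix_cmd diff_body) -> ~~ modR r check_cmd ->
    ~~ modR r next_cmd -> reg t3 r = reg s r.
  by move=> h1 h2 h3; rewrite /t3 eval_reg // t2R.
have t3A t p : ~~ modA t (matrix_cmd diff_body) -> ~~ modA t check_cmd ->
    ~~ modA t next_cmd -> arr t3 t p = arr s t p.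
  by move=> h1 h2 h3; rewrite /t3 eval_arr // t2A.
have t3OK : arr t3 fOK 0 = false by rewrite /t3 eval_arr // t2OK.
have t3o : out t3 = k by rewrite /t3 eval_out.
have t3I x y : mat b t3 tIN x y = adj G x y by rewrite -hG /mat t3A.
have := @eval_next n t2 k (allowed_pairs G k) S.
rewrite !t2R // -/b -/t3 => /(_ s0 s1 s3).
have t2S : stores b t2 tS S by move=> x y; rewrite -hS /mat t2A.
have t2L : stores b t2 tA (allowed_pairs G k) by move=> x y; rewrite -hA /mat t2A.
move=> /(_ t2S t2L SA); rewrite /search_step /=.
case: (next_set _ _ _ _) => [S'|] [t3C t3S].
  rewrite eval_if condA // t3R // s0 (negbTE t3C) eval_nop; split=> //.
  by split=> //=; rewrite ?t3R //; move=> x y; rewrite -hA /mat t3A.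
rewrite eval_if condA // t3R // s0 t3C 4!eval_seq.
set t4 := eval Cout _; set t5 := eval allowed_cmd t4.
have t43 : reg t4 3 = k.+1 by rewrite /= t3R // s3.
have t44 : reg t4 4 = k.+1.*2 by rewrite /= t3R // s4 doubleS.
have t4R r : r != 3 -> r != 4 -> reg t4 r = reg t3 r.
  by move=> /negbTE r3 /negbTE r4; rewrite /t4 /= r3 r4.
have t42 : reg t4 2 = b by rewrite t4R ?t3R.
split; first by rewrite /t5 eval_arr.
have t5R r : ~~ modR r allowed_cmd -> reg t5 r = reg t4 r by move=> h; rewrite /t5 eval_reg.
split=> /=; rewrite ?t5R ?t43 ?t44 ?t42 //.
- by rewrite t4R // t3R.
- by rewrite t4R // t3R.
- by rewrite /t5 eval_out //= t3o.
- by move=> x y; rewrite /mat /t5 eval_arr // -t3I.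
- by move=> x y; rewrite /mat /t5 eval_arr // -t3S.
- move=> x y; rewrite /t5 -[b]t42; apply: eval_allowed => //.
  + by rewrite t4R // t3R.
  + by rewrite t4R // t3R.
  + by move=> u v; rewrite t42 -t3I.
Qed.

Lemma search_step_sub (T : finType) (f : T -> nat) (AL : nat -> {set T}) (c : nat * {set T}) :
  c.2 \subset AL c.1 ->
  (search_step f AL c).2 \subset AL (search_step f AL c).1.
Proof.
case: c => s S /= /subsetP SA; rewrite /search_step /next_set /=.
case: pickP => [p /and4P[pA _ _ _]|_] /=; last exact: sub0set.
by apply/subsetP => q; rewrite inE => /predU1P[-> //|/andP[_ /SA]].
Qed.

Lemma sim_search n (G : sgraph n) s : search_state G (0, set0) s -> arr s fOK 0 = false ->
  exists t s', [/\ t <= (Ie G).+1 * (2 ^ (26 * vc G ^ 4)).+1,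
    sim (while_prog false 0 fOK (compile body_cmd)) s (t.+1 * (cost body_cmd n).+1).+1 s' &
    out s' = Ie G].
Proof.
move=> S0 s0K.
have [t [U [tK tE gU gt]]] := search_correct (@enc_injective n)
  (fun s sI => @card_candidates n G s sI)
  (fun s U sI sU => small_lt_Ie sI sU) (Ie_small G).
pose c j := iter j (search_step (@enc n) (allowed_pairs G)) (0, set0).
pose S j := iter j (eval body_cmd) s.
have cS j : (c j).2 \subset allowed_pairs G (c j).1.
  by elim: j => [|j IH]; [exact: sub0set | exact: search_step_sub].
have SS j : j <= t -> search_state G (c j) (S j) /\ arr (S j) fOK 0 = false.
  elim: j => [|j IH] jt; first by [].
  have [h1 h2] := eval_body (IH (ltnW jt)).1 (cS j).
  by rewrite h1 /= (negbTE (gt j jt)) in h2 *.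
have [h1 h2] := eval_body (SS t (leqnn _)).1 (cS t).
rewrite {1 2}/c tE /= gU in h1 h2.
(* One round more than search steps: the last one performs only the successful test, which leaves
   the flag raised and stops the loop. *)
exists t, (S t.+1); split=> //; last by rewrite [S _]/= h2 /c tE.
apply: (sim_while (S := S)) => //.
- move=> j; rewrite ltnS => jt; have [Ij Kj] := SS j jt.
  split; first by rewrite condA // (ss_zero Ij).
  by rewrite -(ss_n Ij); apply: sim_cmd; [exact: wf_body | exact: ss_zero Ij].
- rewrite condA // [S _]/= eval_reg // (ss_zero (SS t (leqnn _)).1).
  exact: h1.
Qed.

(** * Reading the input and writing the output *)

(** All registers start at 0, so block 0 carries all their marks; input symbol i goes to block i +
    1. *)
Definition first_block := [seq Some (t < nreg) | t <- iota 0 ntrk].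
Definition block a := [seq Some ((t == tIN) && a) | t <- iota 0 ntrk].

Definition append_prog a :=
  Whl (fun a => a != None) (Mv MLeft) ;; wrs (block a) ;; Mv MRight ;; home.

(* The last input symbol is recognised by the blank on its right; the erased input is then
   replaced by zeros, the initial value of the output. *)
Definition take_prog a :=
  Wr None ;; Mv MRight ;;
  Ifc (fun a => a == None)
    (Mv MLeft ;; Whl (fun a => a == None) (Wr (Some false) ;; Mv MLeft) ;;
     Mv MRight ;; Wr None ;; Mv MLeft ;; append_prog a)
    (Mv MLeft ;; Whl (fun a => a == None) (Mv MLeft) ;; append_prog a ;;
     Whl (fun a => a == None) (Mv MRight)).

Definition convert_prog :=
  Mv MLeft ;; Mv MLeft ;; wrs first_block ;; Mv MRight ;; home ;; Mv MRight ;;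
  Whl (fun a => a != None) (Ifc (test true) (take_prog true) (take_prog false)).

Definition input_bit (w : seq sym) t p := [&& t == tIN, 0 < p & nth None w p.-1 == Some true].

Definition input_store w := Store (fun=> 0) (input_bit w) 0.

Lemma cell_next m p : cell m p 0 + ntrk = cell m p.+1 0.
Proof. by rewrite /cell mulSn; lia. Qed.

Lemma cell_split m e x : cell m 0 0 <= x -> x < cell m e 0 ->
  exists p t, [/\ p < e, t < ntrk & x = cell m p t].
Proof.
move=> mx xe; exists ((x - m.+2) %/ ntrk), ((x - m.+2) %% ntrk); split.
- by rewrite ltn_divLR //; move: mx xe; rewrite /cell; lia.
- by rewrite ltn_pmod.
- by have := divn_eq (x - m.+2) ntrk; move: mx; rewrite /cell; lia.
Qed.

Lemma nth_block (F : nat -> bool) t : t < ntrk -> nth None [seq Some (F t) | t <- iota 0 ntrk] t = Some (F t).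
Proof. by move=> tt; rewrite (nth_map 0) ?size_iota // nth_iota. Qed.

(** This is [rep] without the output zone, whose cells still hold the unread input during the
    conversion. *)
Record conv_state (w : seq sym) (m e : nat) (f : nat -> sym) : Prop := ConvState {
  cs_cell : forall p t, p < e -> t < ntrk -> f (cell m p t) = Some (track (input_store w) t p);
  cs_end : forall x, cell m e 0 <= x -> f x = None;
  cs_home : f m.+1 = None;
  cs_zero : f 0 = None }.

Lemma conv_nonblank w m e f x : conv_state w m e f -> cell m 0 0 <= x -> x < cell m e 0 ->
  f x != None.
Proof.
move=> cs mx xe; have [p [t [pe tt ->]]] := cell_split mx xe.
by rewrite (cs_cell cs).
Qed.

Lemma exec_append w m e f a : conv_state w m e.+1 f ->
  a = (nth None w e == Some true) ->
  exists g, [/\ conv_state w m e.+2 g, forall x, x <= m -> g x = f x &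
    exec_le (append_prog a) f m.+2 (400 * (e + 3)) g m.+1].
Proof.
move=> cs aE; set x0 := cell m e.+1 0.
have sz b : size (block b) = ntrk by rewrite size_map size_iota.
pose g := puts f x0 (block a).
have gE x : g x = if x0 <= x < cell m e.+2 0 then nth None (block a) (x - x0) else f x.
  by rewrite /g putsE sz cell_next.
have gL x : x < x0 -> g x = f x by move=> xx; rewrite gE leqNgt xx.
have mx0 : m.+2 <= x0 by rewrite /x0 /cell; lia.
have cg : conv_state w m e.+2 g.
  split.
  - move=> p t; rewrite ltnS leq_eqVlt => /orP[/eqP ->|pe] tt; last first.
      by rewrite gL ?(cs_cell cs) //; rewrite /x0 /cell /ntrk in tt *; lia.
    have xE : cell m e.+1 t = x0 + t by rewrite /x0 /cell addn0.
    rewrite gE xE leq_addr addKn -cell_next ltn_add2l tt nth_block //.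
    rewrite aE /track /input_bit /=; case: ltnP => // tn.
    by rewrite ltn_eqF.
  - move=> x xe; rewrite gE ifF; last by move: xe; lia.
    by apply: (cs_end cs); move: xe; rewrite -[cell m e.+2 0]cell_next -/x0; lia.
  - by rewrite gL ?(cs_home cs).
  - by rewrite gL ?(cs_zero cs) //; lia.
exists g; split=> //; first by move=> x xm; apply: gL; lia.
have X1 : exec_le (Whl (fun a => a != None) (Mv MLeft)) f m.+2 ((x0 - m.+2) * 3).+1 f x0.
  have E : x0 = m.+2 + (x0 - m.+2) by lia.
  rewrite {2}E; apply: walk_left1.
    by move=> y my; apply: (conv_nonblank cs); rewrite /x0 /cell in my *; lia.
  by rewrite -E (cs_end cs).
have X2 := exec_le_wrs (block a) f x0; rewrite sz -/g in X2.
have X3 : exec_le home g (cell m e.+1 39) (((e.+2 * ntrk)) * 3).+1 g m.+1.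
  have -> : cell m e.+1 39 = m.+1 + e.+2 * ntrk by rewrite /cell /ntrk; lia.
  apply: walk_right => [y yy|]; last by rewrite (cs_home cg).
  by apply: (conv_nonblank cg); rewrite /cell; lia.
have E : x0 + ntrk = (cell m e.+1 39).+1 by rewrite /x0 /cell /ntrk; lia.
rewrite E in X2.
refine (exec_leW _ (exec_le_seq X1 (exec_le_seq X2 (exec_le_seq (exec_le_right _ _) X3)))).
by rewrite /x0 /cell /ntrk; lia.
Qed.

Definition conv_tape (w : seq sym) m k (f : nat -> sym) :=
  forall x, x <= m -> f x = if 0 < x <= k then nth None w (m - x) else None.

Lemma exec_convert_loop w m k f : size w = m -> all isSome w -> 0 < k <= m ->
  conv_state w m (m - k).+1 f -> conv_tape w m k f ->
  exists g, rep m m.+1 (input_store w) g /\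
    exec_le (Whl (fun a => a != None) (Ifc (test true) (take_prog true) (take_prog false)))
      f k (k * (500 * (m + 3))).+1 g m.+1.
Proof.
move=> sw /allP allw.
have wS i : i < m -> nth None w i != None.
  rewrite -sw => iw; have := allw _ (mem_nth None iw); by case: (nth _ _ _).
elim: k f => // k IH f /= km cs ft.
have fk : f k.+1 = nth None w (m - k.+1) by rewrite ft // ltnS leqnn.
have fkS : f k.+1 != None by rewrite fk wS //; lia.
pose a := f k.+1 == Some true.
set e := m - k.+1 in fk cs.
have aE : a = (nth None w e == Some true) by rewrite /a fk.
have takeE : (if test true (f k.+1) then take_prog true else take_prog false) = take_prog a.
  by rewrite /test -/a; case: (a).
pose f1 := put f k.+1 None.
have f1E x : x != k.+1 -> f1 x = f x by rewrite /f1 /put => /negbTE ->.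
have cs1 : conv_state w m e.+1 f1.
  split.
  - by move=> p t pe tt; rewrite f1E ?(cs_cell cs) // /cell; lia.
  - move=> x xe; rewrite f1E ?(cs_end cs) //; move: xe; rewrite /cell; lia.
  - by rewrite f1E ?(cs_home cs) //; lia.
  - by rewrite f1E ?(cs_zero cs).
have ft1 : conv_tape w m k f1.
  move=> x xm; case: (eqVneq x k.+1) => [->|xk]; first by rewrite /f1 /put eqxx ltnn.
  by rewrite f1E // ft // [x <= k.+1]leq_eqVlt (negbTE xk) ltnS.
have f1m : f1 m.+2 != None by apply: (conv_nonblank cs1); rewrite /cell /ntrk; lia.
case: (posnP k) => k0.
  have em : e.+2 = m.+1 by rewrite /e; lia.
  (* All m cells of the erased input are filled with zeros and so is the home cell, as it is blank
     too; it has to be blanked again. *)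
  pose f2 := puts f1 1 (nseq m.+1 (Some false)).
  have f2E x : f2 x = if 0 < x <= m.+1 then Some false else f1 x.
    rewrite /f2 putsE size_nseq add1n ltnS; case: ifP => // xm.
    by rewrite nth_nseq ifT //; lia.
  pose f3 := put f2 m.+1 None.
  have f3E x : f3 x = if 0 < x <= m then Some false else if x == m.+1 then None else f1 x.
    rewrite /f3 /put f2E; case: eqP => [->|xm]; first by rewrite ltnn andbF.
    by rewrite [x <= m.+1]leq_eqVlt ltnS; case: eqP.
  have f3L x : m.+1 < x -> f3 x = f1 x by move=> xm; rewrite f3E ifF; [rewrite gtn_eqF|lia].
  have cs3 : conv_state w m e.+1 f3.
    split.
    - by move=> p t pe tt; rewrite f3L ?(cs_cell cs1) // /cell; lia.
    - by move=> x xe; rewrite f3L ?(cs_end cs1) //; move: xe; rewrite /cell; lia.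
    - by rewrite f3E ltnn andbF eqxx.
    - by rewrite f3E /= (cs_zero cs1).
  have [g [cg gf X]] := exec_append cs3 aE.
  exists g; split.
    rewrite em in cg; split.
    - by [].
    - by move=> t p mp; rewrite /= /input_bit nth_default ?andbF //; rewrite sw; lia.
    - exact: (cs_cell cg).
    - exact: (cs_end cg).
    - exact: (cs_home cg).
    - exact: (cs_zero cg).
    - by move=> i im; rewrite gf // f3E ltnS im div0n.
  have X1 : exec_le (Whl (fun a => a == None) (Wr (Some false) ;; Mv MLeft)) f1 1 (m.+1 * 4).+1 f2 m.+2.
    rewrite -[m.+2]add1n; apply: fill_loop.
      by move=> i im; rewrite add1n; have [/eqP ->|im'] := boolP (i == m);
        [rewrite (cs_home cs1) | rewrite ft1 ?k0 //=; lia].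
    by rewrite add1n.
  subst k; have XI := exec_le_seq (exec_le_left f1 0) (exec_le_seq X1
    (exec_le_seq (exec_le_right f2 m.+1) (exec_le_seq (exec_le_wr None f2 m.+1)
    (exec_le_seq (exec_le_left f3 m.+1) X)))).
  have XT := exec_le_seq (exec_le_wr None f 1) (exec_le_seq (exec_le_right f1 0)
    (exec_le_ifc (b := fun a => a == None) (q := Mv MLeft ;; Whl (fun a => a == None) (Mv MLeft) ;;
       append_prog a ;; Whl (fun a => a == None) (Mv MRight)) _)).
  have {}XT := XT _ _ _ _ ltac:(rewrite (cs_zero cs1) eqxx; exact: XI).
  refine (exec_leW _ (exec_le_whlT fkS (exec_le_ifc _) (exec_le_whlF _ _))); last 2 first.
  - by rewrite takeE; exact: XT.
  - by rewrite (cs_home cg).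
  - by rewrite /e; lia.
have [g [cg gf X]] := exec_append cs1 aE.
have eE : e.+2 = (m - k).+1 by rewrite /e; lia.
rewrite eE in cg.
have gt : conv_tape w m k g by move=> x xm; rewrite gf // ft1.
have [|h [Rh Y]] := IH g _ cg gt; first by lia.
exists h; split=> //.
have X1 : exec_le (Whl (fun a => a == None) (Mv MLeft)) f1 k.+1 ((m.+1 - k) * 3).+1 f1 m.+2.
  have -> : m.+2 = k.+1 + (m.+1 - k) by lia.
  apply: walk_left1; last by rewrite (_ : k.+1 + (m.+1 - k) = m.+2) //; lia.
  move=> y ky; have [/eqP ->|ym] := boolP (y == m.+1); first by rewrite (cs_home cs1).
  by rewrite ft1 ?ifF //; lia.
have X2 : exec_le (Whl (fun a => a == None) (Mv MRight)) g m.+1 ((m.+1 - k) * 3).+1 g k.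
  have -> : m.+1 = k + (m.+1 - k) by lia.
  have -> : k + (m.+1 - k) - k = m.+1 - k by lia.
  apply: walk_right; last by rewrite gt ?k0 ?leqnn ?wS //; lia.
  move=> y ky; have [/eqP ->|ym] := boolP (y == m.+1); first by rewrite (cs_home cg).
  by rewrite gt ?ifF //; lia.
have XI := exec_le_seq (exec_le_left f1 k) (exec_le_seq X1 (exec_le_seq X X2)).
have XT := exec_le_seq (exec_le_wr None f k.+1) (exec_le_seq (exec_le_right f1 k)
  (exec_le_ifc (b := fun a => a == None) (p := Mv MLeft ;;
     Whl (fun a => a == None) (Wr (Some false) ;; Mv MLeft) ;;
     Mv MRight ;; Wr None ;; Mv MLeft ;; append_prog a) _)).
have f1k : (f1 k == None) = false.
  by rewrite ft1 ?k0 ?leqnn /=; [apply/negbTE/wS|]; lia.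
have {}XT := XT _ _ _ _ ltac:(rewrite f1k; exact: XI).
refine (exec_leW _ (exec_le_whlT fkS (exec_le_ifc _) Y)); last by rewrite takeE; exact: XT.
by rewrite [k.+1 * _]mulSn /e; lia.
Qed.

Definition input_tape (w : seq sym) x :=
  if 0 < x <= size w then nth None w (size w - x) else None.

Lemma exec_convert w m : size w = m -> 0 < m -> all isSome w ->
  exists g, rep m m.+1 (input_store w) g /\
    exec_le convert_prog (input_tape w) m (2000 * (m + 3) ^ 2) g m.+1.
Proof.
move=> sw m0 allw; set f := input_tape w.
have fE x : m < x -> f x = None by rewrite /f /input_tape sw => xm; rewrite ifF //; lia.
have sz : size first_block = ntrk by rewrite size_map size_iota.
pose f1 := puts f m.+2 first_block.
have f1E x : f1 x = if m.+2 <= x < m.+2 + ntrk then nth None first_block (x - m.+2) else f x.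
  by rewrite /f1 putsE sz.
have f1L x : x < m.+2 -> f1 x = f x by move=> xm; rewrite f1E leqNgt xm.
have cs : conv_state w m 1 f1.
  split.
  - move=> [|//] t _ tt; rewrite f1E /cell mul0n addn0 leq_addr ltn_add2l tt addKn nth_block //.
    by rewrite /track /= /input_bit ltnn andbF; case: ltnP.
  - by move=> x xe; rewrite f1E ifF ?fE //; move: xe; rewrite /cell; lia.
  - by rewrite f1L ?fE.
  - by rewrite f1L // /f /input_tape.
have ct : conv_tape w m m f1 by move=> x xm; rewrite f1L /f /input_tape ?sw //; lia.
have [||g [Rg X]] := exec_convert_loop sw allw (k := m) _ _ ct; first by lia.
  by rewrite subnn.
exists g; split=> //.
have X1 := exec_le_wrs first_block f m.+2; rewrite sz -/f1 in X1.
have E : m.+2 + ntrk = (cell m 0 39).+1 by rewrite /cell /ntrk; lia.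
rewrite E in X1.
have X2 : exec_le home f1 (cell m 0 39) (130 * (m + 1 + 3)) f1 m.+1.
  apply: exec_home => //; first exact: (cs_home cs).
  by move=> q u qe ut; rewrite (cs_cell cs).
refine (exec_leW _ (exec_le_seq (exec_le_left f m) (exec_le_seq (exec_le_left f m.+1)
  (exec_le_seq X1 (exec_le_seq (exec_le_right f1 _) (exec_le_seq X2
  (exec_le_seq (exec_le_right f1 m) X))))))).
have : m * (500 * (m + 3)) <= 500 * (m + 3) ^ 2.
  by rewrite mulnCA leq_mul2l /= expnS expn1 leq_mul2r leq_addr orbT.
have : m + 3 <= (m + 3) ^ 2 by rewrite expnS expn1 leq_pmulr //; lia.
have : 9 <= (m + 3) ^ 2 by rewrite (@leq_exp2r 3 _ 2) ?leq_addl.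
by rewrite /ntrk; lia.
Qed.

(** * Parsing, the complete program and its output *)

Definition parse_prog :=
  inc_prog 16 ;; while_prog true 16 tIN (inc_prog 16 ;; inc_prog 1) ;;
  copy_prog 2 16 ;; inc_prog 2.

(** Parsing counts the leading ones and ends with register 16 at the separator, in block n + 1, so
    the matrix starts at n + 2. The final move goes from the home cell to the most significant bit
    of the output, where reading begins. *)
Definition main_prog :=
  convert_prog ;; (parse_prog ;; while_prog false 0 fOK (compile body_cmd)) ;; Mv MRight.

Lemma size_encode n (G : sgraph n) : size (encode G) = n + (n * n).+1.
Proof.
by rewrite size_cat size_nseq /= size_allpairs size_enum_ord.
Qed.

Lemma nth_encode_ones n (G : sgraph n) i : i < n -> nth None (encode G) i = Some true.
Proof. by move=> ni; rewrite nth_cat size_nseq ni nth_nseq ni. Qed.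

Lemma nth_encode_sep n (G : sgraph n) : nth None (encode G) n = Some false.
Proof. by rewrite nth_cat size_nseq ltnn subnn. Qed.

Lemma nth_encode_adj n (G : sgraph n) (x y : 'I_n) :
  nth None (encode G) (n.+1 + (x * n + y)) = Some (adj G x y).
Proof.
rewrite nth_cat size_nseq ifF; last by lia.
have -> : n.+1 + (x * n + y) - n = (x * n + y).+1 by lia.
have L (s : seq 'I_n) k z : k < size s ->
    nth None [seq Some (adj G i j) | i <- s, j <- enum 'I_n] (k * n + z) =
    if z < n then nth None [seq Some (adj G (nth x s k) j) | j <- enum 'I_n] z
    else nth None [seq Some (adj G i j) | i <- s, j <- enum 'I_n] (k * n + z).
  elim: s k => //= a s IH [|k] ks; case: ifP => // zn.
    by rewrite mul0n add0n nth_cat size_map size_enum_ord zn.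
  rewrite nth_cat size_map size_enum_ord ifF; last by rewrite mulSn; lia.
  by rewrite mulSn -addnA addKn IH // zn.
rewrite /= L ?size_enum_ord ?ltn_ord // nth_ord_enum.
by rewrite (nth_map x) ?size_enum_ord // nth_ord_enum.
Qed.

Lemma all_encode n (G : sgraph n) : all isSome (encode G).
Proof.
rewrite all_cat all_nseq orbT /=; apply/allP => a /allpairsP[[x y] /= [_ _ ->]] //.
Qed.

Lemma sim_parse n (G : sgraph n) : exists s,
  [/\ sim parse_prog (input_store (encode G)) (3 * n + 4) s,
      search_state G (0, set0) s & arr s fOK 0 = false].
Proof.
set w := encode G.
pose S j := Store (fun r => if r == 1 then j else if r == 16 then j.+1 else 0)
  (arr (input_store w)) 0.
(* Stores contain functions, so they are identified pointwise. *)
have ext P s D (s1 s2 : store) : (forall r, reg s1 r = reg s2 r) ->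
    (forall t p, arr s1 t p = arr s2 t p) -> out s1 = out s2 -> sim P s D s1 -> sim P s D s2.
  move=> eR eA eO simP m e f /simP[f' [e' [Rp E X]]]; exists f', e'; split=> //.
  case: Rp => R1 R2 R3 R4 R5 R6 R7; split=> //.
  - by move=> r rr; rewrite -eR R1.
  - by move=> t p ep; rewrite -eA R2.
  - by move=> p t pe tt; rewrite R3 // /track eR eA.
  - by move=> i im; rewrite R7 // eO.
have i1 : sim (inc_prog 16) (input_store w) 1 (S 0).
  by apply: ext (sim_inc (r := 16) _) => // r /=; case: (eqVneq r 16) => [->|_] //; case: ifP.
have i2 : sim (while_prog true 16 tIN (inc_prog 16 ;; inc_prog 1)) (S 0) (n * 3).+1 (S n).
  apply: sim_while => // [j jn|].
    split; first by rewrite condA //= /input_bit /= nth_encode_ones.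
    apply: ext (sim_seq (sim_inc (r := 16) _) (sim_inc (r := 1) _)) => // r /=.
    by case: (eqVneq r 1) => //= _; case: (eqVneq r 16) => //= ->.
  by rewrite condA //= /input_bit /= nth_encode_sep.
pose s := incR 2 (setR 2 n.+1 (S n)).
exists s; split.
- have -> : 3 * n + 4 = 1 + ((n * 3).+1 + (1 + 1)) by lia.
  apply: sim_seq i1 (sim_seq i2 (sim_seq (sim_copy (r := 2) (r' := 16) _ _ _) (sim_inc (r := 2) _))) => //.
- split=> //= x y.
  + rewrite /mat /= /input_bit /=.
    by rewrite -[n.+1 + _]/(n.+1 + (x * n + y)) nth_encode_adj; case: (adj G x y).
  + by rewrite /mat /= /input_bit /= inE.
  + by rewrite /mat /= /input_bit /= !inE; apply/esym/negbTE/negP => /and3P[].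
- by [].
Qed.

Lemma bits_until_blankE (b : nat -> bool) m (s : seq sym) :
  (forall i, i < m -> nth None s i = Some (b i)) -> nth None s m = None ->
  bits_until_blank s = mkseq b m.
Proof.
elim: m b s => [|m IH] b s sb sm; first by case: s sm {sb} => //= a s ->.
case: s sb sm => [|a s] sb sm; first by have := sb 0 isT.
have /= -> := sb 0 isT; rewrite /mkseq /= -[1]/(1 + 0) iotaDl -map_comp; congr (_ :: _).
by apply: (IH (fun i => b i.+1)) => // i im; apply: (sb i.+1).
Qed.

Lemma bin_val_rcons s b : bin_val (rcons s b) = (bin_val s).*2 + b.
Proof. by rewrite /bin_val foldl_rcons. Qed.

Lemma bin_val_bits m o : o < 2 ^ m -> bin_val (mkseq (fun i => bit o (m - i.+1)) m) = o.
Proof.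
elim: m o => [|m IH] o om; first by move: om; case: o.
rewrite mkseqS bin_val_rcons subnn bit0S.
have -> : mkseq (fun i => bit o (m.+1 - i.+1)) m = mkseq (fun i => bit o./2 (m - i.+1)) m.
  apply/eq_in_map => i; rewrite mem_iota /= add0n => im.
  by rewrite -bitS; congr bit; lia.
by rewrite IH; [rewrite addnC odd_double_half | rewrite expnS in om; lia].
Qed.

(** Guarantees that the answer fits into the m = n + n^2 + 1 bits of the output, so that counting
    modulo 2^m loses nothing. *)
Lemma Ie_le_sq n (G : sgraph n) : Ie G <= n * n.
Proof.
have [S _ <-] := Ie_attained G.
by apply: leq_trans (max_card _) _; rewrite card_prod card_ord.
Qed.

Lemma run_main_prog n (G : sgraph n) m : m = n + (n * n).+1 -> exists D t,
  [/\ D <= 3 * n + 4 + (((Ie G).+1 * (2 ^ (26 * vc G ^ 4)).+1).+1 * (cost body_cmd n).+1).+1,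
    t <= 2000 * (m + 3) ^ 2 + D * tick m (m.+1 + D) + 1,
    halted (run t (init_config (tm_of main_prog) (encode G))) &
    output (run t (init_config (tm_of main_prog) (encode G))) = Ie G].
Proof.
move=> mE; have sw : size (encode G) = m by rewrite size_encode.
have m0 : 0 < m by rewrite mE addnS.
have [f [Rf X1]] := exec_convert sw m0 (all_encode G).
have [s1 [simP S1 K1]] := sim_parse G.
have [u [s2 [uB simS O2]]] := sim_search S1 K1.
have [g [e [Rg _ X2]]] := sim_seq simP simS Rf.
set D := _ + _ in X2; exists D.
have [t tB E] : exec_le main_prog (input_tape (encode G)) m
  (2000 * (m + 3) ^ 2 + (D * tick m (m.+1 + D) + 1)) g m.
  exact: exec_le_seq X1 (exec_le_seq X2 (exec_le_right g m)).
have tr : tape_rel (input_tape (encode G)) m [::] (head None (encode G)) (behead (encode G)).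
  split.
  - by rewrite /input_tape sw m0 leqnn subnn nth0.
  - by move=> i; rewrite nth_nil /input_tape sw ifF //; lia.
  - move=> i; rewrite nth_behead /input_tape sw; case: ltnP => im.
      have [mi|im'] := eqVneq m i.+1; first by rewrite mi subnn /= nth_default // sw mi.
      by rewrite ifT; [congr nth; lia | lia].
    by rewrite nth_default // sw leqW.
have [l [r [[_ _ rE] hal outE]]] := run_tm_of E tr.
exists t; split=> //.
- rewrite /D leq_add2l ltnS leq_mul2r; apply/orP; right; rewrite ltnS; exact: uB.
- by rewrite -addnA.
rewrite outE -O2 -[RHS](@bin_val_bits m); last first.
  rewrite O2; apply: leq_ltn_trans (Ie_le_sq G) _; apply: leq_trans (ltn_expl _ (leqnn 2)) _.
  by rewrite leq_exp2l // mE; lia.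
congr bin_val; apply: bits_until_blankE => [i im|] /=.
- have gO j : j < m -> g j.+1 = Some (bit (out s2) j) := @rep_out _ _ _ _ Rg j.
  case: i im => [|i] im /=; first by rewrite -{1}(prednK m0) gO ?subn1 // prednK.
  rewrite rE ifT; last by lia.
  by rewrite (_ : m - i.+1 = (m - i.+2).+1) ?gO //; lia.
- by rewrite -[X in nth _ _ X](prednK m0) /= rE prednK // leqnn subnn (rep_zero Rg).
Qed.

Theorem theorem3 :
  exists (M : TM) (c d : nat),
    forall (n : nat) (G : sgraph n),
      exists t : nat,
        (t <= c * 2 ^ (c * vc G ^ 4) * n.+1 ^ d)%N /\
        halted (run t (init_config M (encode G))) /\
        output (run t (init_config M (encode G))) = Ie G.
Proof.
have [K [d costB]] := cost_poly body_cmd.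
(* The search contributes 3 (K + 1) Y to the instruction count, with Y as below; parsing and the
   additive constants, 3 n + 5 in all, are at most 5 Y. *)
pose A := 3 * K + 8.
(* The summands pay for the last move, for the conversion of the input with m + 3 <= 4 Y, and for at
   most A Y instructions of at most 2000 (8 + A) Y steps each. *)
have [c cE] : exists c, c = 1 + 32 * 1000 + 2000 * (A * (8 + A)) by eexists.
exists (tm_of main_prog), c, (d.+2 * 2) => n G.
have [D [t [DB tB hal outE]]] := run_main_prog G erefl; exists t; split=> //.
set m := n + (n * n).+1 in tB; move: DB (costB n) (Ie_le_sq G).
set I := Ie G; set C := cost _ _; set X := 2 ^ (26 * _); set N := n.+1 => DB CB IB.
pose Y := N ^ d.+2 * X.
have X0 : 0 < X by rewrite expn_gt0.
have N0 : 0 < N ^ d by rewrite expn_gt0.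
have YE : Y = N * N * (N ^ d * X) by rewrite /Y !expnS !mulnA.
have NY : N * N <= Y by rewrite YE leq_pmulr // muln_gt0 N0.
have Y0 : 0 < Y by apply: leq_trans NY; rewrite muln_gt0.
have NN : n * n + 2 * n + 1 = N * N by rewrite /N mulSn mulnS; lia.
have mY : m + 3 <= 4 * Y by rewrite /m; lia.
have DY : D <= A * Y.
  have h1 : (I.+1 * X.+1).+1 <= 3 * (N * N * X).
    have : I.+1 * X.+1 <= (N * N) * (2 * X) by apply: leq_mul; lia.
    have : 0 < N * N * X by rewrite !muln_gt0 X0.
    by lia.
  have h2 : C.+1 <= K.+1 * N ^ d by rewrite mulSn; lia.
  have := leq_mul h1 h2.
  have -> : 3 * (N * N * X) * (K.+1 * N ^ d) = 3 * K.+1 * Y by rewrite YE; nia.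
  by rewrite /A mulnDl; lia.
have tY : t <= c * (Y * Y).
  have h1 : (m + 3) ^ 2 <= 16 * (Y * Y).
    by rewrite expnS expn1; apply: leq_trans (leq_mul mY mY) _; lia.
  have h2 : tick m (m.+1 + D) <= 2000 * ((8 + A) * Y) by rewrite /tick mulnDl; lia.
  have := leq_mul DY h2.
  have -> : A * Y * (2000 * ((8 + A) * Y)) = 2000 * (A * (8 + A)) * (Y * Y) by nia.
  have : 0 < Y * Y by rewrite muln_gt0 Y0.
  have -> : c * (Y * Y) = Y * Y + 32 * (1000 * (Y * Y)) + 2000 * (A * (8 + A)) * (Y * Y).
    by rewrite cE (mulnDl (1 + _)) (mulnDl 1) mul1n -[32 * 1000 * _]mulnA.
  by lia.
apply: leq_trans tY _; rewrite -mulnA leq_mul2l; apply/orP; right.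
have -> : Y * Y = X * X * N ^ (d.+2 * 2).
  by rewrite expnM /Y; move: (N ^ d.+2) => P; rewrite -[P ^ 2]mulnn mulnACA mulnC.
rewrite leq_mul2r; apply/orP; right.
(* Squaring doubles the exponent to 52 k^4, and c is larger than 52. *)
rewrite /X -expnD leq_exp2l // -mulnDl leq_mul2r; apply/orP; right.
by rewrite cE; lia.
Qed.
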